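(* For every $\alpha\in(0,1]$ there are constants $C(\alpha),c(\alpha)>0$ depending only on $\alpha$ such that the following holds. Let $n\ge1$, let $\eta_1,\dots,\eta_n$ be i.i.d. with distribution $\mathcal{W}_s(\alpha)$, put $\eta=(\eta_1,\dots,\eta_n)^\top$, and let $A=(a_{ij})_{n\times n}$ be a fixed real symmetric diagonal-free matrix. Then for all $t\ge0$, $$\mathbb{P}\left\{|\eta^\top A\eta-\mathbb{E}\,\eta^\top A\eta|\ge t\right\}\ge C(\alpha)\exp(-c(\alpha)f_2(t)),$$ where $$f_2(t)=\min\left\{\left(\frac{t}{\|A\|_F}\right)^2,\ \frac{t}{\|A\|_{l_2\to l_2}},\ \left(\frac{t}{\|A\|_{l_2\to l_\infty}}\right)^{\frac{2\alpha}{2+\alpha}},\ \left(\frac{t}{\|A\|_\infty}\right)^{\frac{\alpha}{2}}\right\}.$$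
   Context: $\mathcal{W}_s(\alpha)$ is the symmetric Weibull distribution with scale parameter $1$ and shape parameter $\alpha$: the law of a symmetric random variable $\xi$ with $\mathbb{P}\{|\xi|>x\}=e^{-x^\alpha}$ for $x\ge0$. Diagonal-free means $a_{ii}=0$ for all $i$. $\|A\|_F$ is the Frobenius norm, $\|A\|_{l_2\to l_2}$ the spectral norm, $\|A\|_{l_2\to l_\infty}=\max_i(\sum_ja_{ij}^2)^{1/2}$, and $\|A\|_\infty=\max_{i,j}|a_{ij}|$. Quotients with zero denominator (which occur only for $A=0$) are read as $x/0=+\infty$ for $x>0$ and $0/0=0$. *)

(* Defs.v *)
From HB Require Import structures.
From mathcomp Require Import all_boot all_order all_algebra.
From mathcomp Require Import all_classical all_reals all_analysis.

Set Implicit Arguments.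
Unset Strict Implicit.
Unset Printing Implicit Defensive.

Import Order.TTheory GRing.Theory Num.Theory.
Import numFieldNormedType.Exports.

Local Open Scope classical_set_scope.
Local Open Scope ring_scope.

(* The library's norm [mx_norm] on matrices, hence on column vectors, is the
   entrywise maximum, so the Euclidean norm is defined here. *)
Definition l2norm (R : realType) (n : nat) (x : 'cV[R]_n) : R :=
  Num.sqrt (\sum_(i < n) x i 0 ^+ 2).

Definition frobenius_norm (R : realType) (n : nat) (A : 'M[R]_n) : R :=
  Num.sqrt (\sum_(i < n) \sum_(j < n) A i j ^+ 2).

Definition spectral_norm (R : realType) (n : nat) (A : 'M[R]_n) : R :=
  sup [set l2norm (A *m x) | x in [set x : 'cV[R]_n | l2norm x <= 1]].

Definition l2_linfty_norm (R : realType) (n : nat) (A : 'M[R]_n) : R :=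
  \big[Num.max/0]_(i < n) Num.sqrt (\sum_(j < n) A i j ^+ 2).

(* The quotients are taken in [\bar R], where [0^-1 = +oo] and [0 * +oo = 0]:
   thus [x / 0 = +oo] for [0 < x] and [0 / 0 = 0].  The norm [mx_norm A] is max_{i,j} |a_ij|. *)
Definition f2 (R : realType) (alpha : R) (n : nat) (A : 'M[R]_n) (t : R) :
    \bar R :=
  Order.min ((t%:E / (frobenius_norm A)%:E) ^+ 2)%E
 (Order.min (t%:E / (spectral_norm A)%:E)%E
 (Order.min
    ((t%:E / (l2_linfty_norm A)%:E) `^ (2 * alpha / (2 + alpha)))%E
    ((t%:E / (mx_norm A)%:E) `^ (alpha / 2))%E)).

(* [mu] is the law W_s(alpha). *)
Definition symmetric_weibull (R : realType) (alpha : R)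
    (mu : set R -> \bar R) : Prop :=
  (forall B : set R, measurable B -> mu (-%R @^-1` B) = mu B) /\
  (forall x : R, 0 <= x ->
     mu [set y | x < `|y|] = (expR (- (x `^ alpha)))%:E).

Definition mutually_independent (R : realType) (d : measure_display)
    (T : measurableType d) (P : probability T R) (n : nat)
    (X : 'I_n -> {RV P >-> R}) : Prop :=
  forall (J : {set 'I_n}) (B : 'I_n -> set R),
    (forall i, measurable (B i)) ->
    P (\bigcap_(i in [set` J]) X i @^-1` B i) =
    (\prod_(i in J) P (X i @^-1` B i))%E.

Definition random_vector (R : realType) (d : measure_display)
    (T : measurableType d) (P : probability T R) (n : nat)
    (X : 'I_n -> {RV P >-> R}) (w : T) : 'cV[R]_n :=
  \col_(i < n) X i w.

Definition quadratic_form (R : realType) (n : nat) (A : 'M[R]_n)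
    (x : 'cV[R]_n) : R :=
  (x^T *m A *m x) 0 0.

(* Main.v *)
Require Import Defs.
From HB Require Import structures.
From mathcomp Require Import all_boot all_order all_algebra.
From mathcomp Require Import all_classical all_reals all_analysis.
From mathcomp Require Import ring lra.

(* The tails of the quadratic form are bounded below for an arbitrary centring
   [m] instead of the mean.  Flipping the signs of the variables in a set [I]
   preserves their law and changes the form by four times its [I] x [~: I] part,
   so P(|Q - m| >= t) is at least half of P(|B| >= t / 2) for the decoupled
   bilinear form B.  Conditionally on one half of the variables B is a linear
   form, and linear forms sum_j c_j eta_j have Gaussian lower tails
   exp(- C t^2 / |c|^2) at all levels, since the variables have heavier tails
   than a Gaussian.  What remains is a lower bound for the Euclidean norm of the
   coefficients of this linear form: it is of order |A|_F with probability
   bounded below, it exceeds u |A| with probability exp(- C u^2), and when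
   [I] = {i} it is |eta_i| times the norm of the i-th row; the largest entry is
   handled directly.  Balancing the two factors gives the four terms of [f2].

   All of this is carried out for finitely supported laws; the Weibull variables
   are rounded to a fine grid, which is harmless for the statement at fixed t. *)

Set Implicit Arguments.
Unset Strict Implicit.
Unset Printing Implicit Defensive.

Import Order.TTheory GRing.Theory Num.Theory.
Import numFieldNormedType.Exports.

Local Open Scope classical_set_scope.
Local Open Scope ring_scope.

(** * Finite product laws *)

(** Symmetry is encoded by an involution of the atoms rather than of their values, so that every
    sign flip becomes a reindexing of a finite sum. *)
Record symlaw (R : realType) := SymLaw {
  sl_T :> finType;
  sl_p : sl_T -> R;
  sl_x : sl_T -> R;
  sl_neg : sl_T -> sl_T;
  sl_p_ge0 : forall v, 0 <= sl_p v;
  sl_p1 : \sum_v sl_p v = 1;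
  sl_negK : involutive sl_neg;
  sl_pN : forall v, sl_p (sl_neg v) = sl_p v;
  sl_xN : forall v, sl_x (sl_neg v) = - sl_x v }.

Section FiniteProduct.
Variables (R : realType) (S : symlaw R) (n : nat).
Local Notation Om := {ffun 'I_n -> S}.
Local Notation p := (@sl_p R S).
Local Notation x := (@sl_x R S).
Local Notation neg := (@sl_neg R S).

Definition Ex (f : Om -> R) : R := \sum_(w : Om) (\prod_j p (w j)) * f w.
Definition Pr (E : Om -> bool) : R := Ex (fun w => (E w)%:R).

Lemma weight_ge0 (w : Om) : 0 <= \prod_j p (w j).
Proof. by apply: prodr_ge0 => j _; apply: sl_p_ge0. Qed.

Lemma eq_Ex (f g : Om -> R) : f =1 g -> Ex f = Ex g.
Proof. by move=> fg; apply: eq_bigr => w _; rewrite fg. Qed.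

Lemma le_Ex (f g : Om -> R) : (forall w, f w <= g w) -> Ex f <= Ex g.
Proof.
by move=> fg; apply: ler_sum => w _; rewrite ler_wpM2l ?weight_ge0.
Qed.

Lemma ExD (f g : Om -> R) : Ex (fun w => f w + g w) = Ex f + Ex g.
Proof. by rewrite -big_split; apply: eq_bigr => w _; rewrite mulrDr. Qed.

Lemma ExZ (c : R) (f : Om -> R) : Ex (fun w => c * f w) = c * Ex f.
Proof. by rewrite mulr_sumr; apply: eq_bigr => w _; rewrite mulrCA. Qed.

Lemma Ex_sum (I : Type) (r : seq I) (f : I -> Om -> R) :
  Ex (fun w => \sum_(i <- r) f i w) = \sum_(i <- r) Ex (f i).
Proof.
by rewrite exchange_big; apply: eq_bigr => w _; rewrite mulr_sumr.
Qed.

Lemma Ex_prod (f : 'I_n -> S -> R) :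
  Ex (fun w => \prod_j f j (w j)) = \prod_j \sum_v p v * f j v.
Proof. by rewrite bigA_distr_bigA; apply: eq_bigr => w _; rewrite big_split. Qed.

Lemma Ex_cst (c : R) : Ex (fun=> c) = c.
Proof.
have -> : Ex (fun=> c) = c * Ex (fun w => \prod_j (fun _ _ => 1) j (w j)).
  by rewrite -ExZ; apply: eq_Ex => w /=; rewrite big1 // mulr1.
rewrite (Ex_prod (fun _ _ => 1)) big1 ?mulr1 // => j _.
by rewrite -[RHS](sl_p1 S); apply: eq_bigr => v _; rewrite mulr1.
Qed.

Lemma Pr_le (E F : Om -> bool) : (forall w, E w -> F w) -> Pr E <= Pr F.
Proof.
move=> EF; apply: le_Ex => w; have := EF w.
by case: (E w) => [-> //|_]; case: (F w).
Qed.

Lemma Pr_ge0 (E : Om -> bool) : 0 <= Pr E.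
Proof. by rewrite -(Ex_cst 0); apply: le_Ex => w. Qed.

Lemma Pr_marginal (i : 'I_n) (E : pred S) :
  Pr (fun w => E (w i)) = \sum_(v | E v) p v.
Proof.
pose f (j : 'I_n) (v : S) : R := if j == i then (E v)%:R else 1.
have -> : Pr (fun w => E (w i)) = Ex (fun w => \prod_j f j (w j)).
  apply: eq_Ex => w; rewrite (bigD1 i) //= /f eqxx big1 ?mulr1 // => j.
  by move/negPf => ->.
rewrite Ex_prod (bigD1 i) //= [X in _ * X]big1 ?mulr1 => [|j /negPf ji].
  rewrite [RHS]big_mkcond; apply: eq_bigr => v _.
  by rewrite /f eqxx; case: (E v); rewrite ?mulr1 ?mulr0.
by rewrite -[RHS](sl_p1 S); apply: eq_bigr => v _; rewrite /f ji mulr1.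
Qed.

Lemma Pr_union (I : finType) (E : I -> Om -> bool) (F : Om -> bool) :
  (forall w, F w -> exists i, E i w) -> Pr F <= \sum_i Pr (E i).
Proof.
move=> FE; rewrite -Ex_sum; apply: le_Ex => w.
have := FE w; case: (F w) => [/(_ isT) [i Ei]|_]; last by apply: sumr_ge0.
by rewrite (bigD1 i) //= Ei lerDl sumr_ge0.
Qed.

Definition flip (b : 'I_n -> pred S) (w : Om) : Om :=
  [ffun j => if b j (w j) then neg (w j) else w j].

(** Whether a coordinate is flipped may depend on its value; invariance of [b j] under [neg] makes
    [flip b] an involution, and it preserves the weights. *)
Lemma Ex_flip (b : 'I_n -> pred S) (f : Om -> R) :
  (forall j v, b j (neg v) = b j v) -> Ex (fun w => f (flip b w)) = Ex f.
Proof.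
move=> bN; have flipK : involutive (flip b).
  move=> w; apply/ffunP => j; rewrite !ffunE.
  by case h: (b j (w j)); rewrite ?bN h ?sl_negK.
rewrite /Ex [RHS](reindex_inj (inv_inj flipK)); apply: eq_bigr => w _.
congr (_ * _); apply: eq_bigr => j _; rewrite ffunE.
by case: ifP => // _; rewrite sl_pN.
Qed.

(** [w] and [flip b w] have the same law, so their two chances of lying in [F] together cover
    [E]. *)
Lemma Pr_flip (b : 'I_n -> pred S) (E F : Om -> bool) :
  (forall j v, b j (neg v) = b j v) ->
  (forall w, E w -> F w || F (flip b w)) -> Pr E <= 2 * Pr F.
Proof.
move=> bN EF; have -> : 2 * Pr F = Pr F + Ex (fun w => (F (flip b w))%:R).
  by rewrite (Ex_flip (fun w => (F w)%:R) bN) mulr_natl mulr2n.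
rewrite -ExD.
apply: le_Ex => w; have := EF w.
case: (E w) => [/(_ isT)|_]; last by rewrite addr_ge0.
by case/orP => ->; rewrite ?lerDl ?lerDr.
Qed.

Definition glue (I : {set 'I_n}) (w w' : Om) : Om :=
  [ffun j => if j \in I then w j else w' j].

(** Exchanging the coordinates outside [I] between two independent copies is an involution of the
    doubled space that preserves its weight. *)
Lemma Ex_glue (I : {set 'I_n}) (f : Om -> R) :
  Ex (fun w => Ex (fun w' => f (glue I w w'))) = Ex f.
Proof.
pose wt (w : Om) := \prod_j p (w j).
have -> : Ex f = \sum_(u : Om * Om) wt u.1 * wt u.2 * f u.1.
  rewrite -(pair_bigA _ (fun w w' => wt w * wt w' * f w)) /=.
  apply: eq_bigr => w _; rewrite -[f w]/((fun=> f w) w) -{1}(Ex_cst (f w)).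
  by rewrite mulr_sumr; apply: eq_bigr => w' _; rewrite mulrA.
pose h (u : Om * Om) := (glue I u.1 u.2, glue I u.2 u.1).
have hK : involutive h.
  move=> [w w']; congr (_, _); apply/ffunP => j; rewrite !ffunE /=;
  by case: ifP => // /[dup] ->.
rewrite [RHS](reindex_inj (inv_inj hK)).
rewrite -(pair_bigA _ (fun w w' => wt (h (w,w')).1 * wt (h (w,w')).2 * f (h (w,w')).1)) /=.
apply: eq_bigr => w _; rewrite mulr_sumr; apply: eq_bigr => w' _.
rewrite mulrA; congr (_ * _); rewrite /wt -!big_split /=.
by apply: eq_bigr => j _; rewrite !ffunE; case: ifP => // _; rewrite mulrC.
Qed.

(** A pointwise bound is averaged: [Y] is at most m/2 below the threshold, and at most t/2 Y^2 +
    1/(2t) above it by AM-GM. *)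
Lemma paley_zygmund (Y : Om -> R) (s : R) :
  0 < Ex Y -> 0 < s -> Ex (fun w => Y w ^+ 2) <= s ->
  Ex Y ^+ 2 / (4 * s) <= Pr (fun w => Ex Y / 2 <= Y w).
Proof.
move=> m0 s0 Ys; set m := Ex Y in m0 *; set q := Pr _.
(* With this choice the second-moment term is at most m/4, so the probability term must supply the
   remaining m/4. *)
pose t := m / (2 * s).
have t0 : 0 < t by rewrite divr_gt0 // mulr_gt0.
have : m <= m / 2 + (t / 2 * Ex (fun w => Y w ^+ 2) + (2 * t)^-1 * q).
  rewrite -(Ex_cst (m / 2)) -!ExZ -!ExD; apply: le_Ex => w.
  case: (leP (m / 2) (Y w)) => /= h; last first.
    rewrite mulr0n mulr0 addr0; apply: (le_trans (ltW h)); rewrite lerDl.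
    by rewrite mulr_ge0 ?sqr_ge0 // divr_ge0 // ltW.
  rewrite mulr1n mulr1 -[leLHS]add0r; apply: lerD; first by rewrite divr_ge0 // ltW.
  have : 0 <= (t * Y w - 1) ^+ 2 / (2 * t).
    by rewrite divr_ge0 ?sqr_ge0 // mulr_ge0 // ltW.
  suff -> : (t * Y w - 1) ^+ 2 / (2 * t) = t / 2 * Y w ^+ 2 + (2 * t)^-1 - Y w by rewrite subr_ge0.
  by field; rewrite gt_eqF.
have -> : (2 * t)^-1 = s / m by rewrite /t; field; rewrite !gt_eqF.
move=> H; have {}H : m <= m / 2 + (t / 2 * s + s / m * q).
  apply: (le_trans H); rewrite lerD2l lerD2r ler_wpM2l // divr_ge0 // ltW //.
have : m / 4 <= s / m * q.
  have ts : t / 2 * s = m / 4 by rewrite /t; field; rewrite gt_eqF.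
  by move: H; rewrite ts; set X := s / m * q; lra.
rewrite -(ler_pM2l (divr_gt0 m0 s0)).
have -> : m / s * (s / m * q) = q by field; rewrite !gt_eqF.
by congr (_ <= _); field; rewrite gt_eqF.
Qed.

(** Off the event [Y] is below c/2 M and on it at most M, so a mean of c M forces the event to have
    probability c/2. *)
Lemma reverse_markov (Y : Om -> R) (M c : R) : 0 < M -> 0 <= c ->
  (forall w, Y w <= M) -> c * M <= Ex Y ->
  c / 2 <= Pr (fun w => c / 2 * M <= Y w).
Proof.
move=> M0 c0 YM cM; set q := Pr _.
suff : Ex Y <= c / 2 * M + M * q.
  move/(le_trans cM); rewrite -lerBlDl [M * q]mulrC -mulrBl ler_pM2r //.
  by congr (_ <= _); field.
rewrite -(Ex_cst (c / 2 * M)) -ExZ -ExD; apply: le_Ex => w.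
have cM0 : 0 <= c / 2 * M by rewrite mulr_ge0 ?divr_ge0 // ltW.
case: (leP (c / 2 * M) (Y w)) => /= h; first by rewrite mulr1n mulr1 (le_trans (YM w)) // lerDr.
by rewrite mulr0n mulr0 addr0 ltW.
Qed.

End FiniteProduct.

(** * Lower tails of linear forms *)

(* The factor 2 in the exponent leaves room for the rounding error.  The range
   [u <= K] is finite because the law has finite support. *)
Definition weibull_like (R : realType) (alpha q K : R) (S : symlaw R) : Prop :=
  forall u, 1 <= u <= K ->
    q * expR (- (2 * u `^ alpha)) <=
    \sum_(v : S | u <= `|sl_x v| <= 2 * u) sl_p v.

(** * Elementary inequalities for the exponential *)

Section LinearForms.
Variable R : realType.
Implicit Types x y z : R.

(** For y >= 0 and h = y/2 the right side is 2 + (e^h - e^-h)^2, and e^h - e^-h >= h; negative y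
    follow by symmetry. *)
Lemma expR_add_ge y : 2 + y ^+ 2 / 4 <= expR y + expR (- y).
Proof.
have pos z : 0 <= z -> 2 + z ^+ 2 / 4 <= expR z + expR (- z).
  move=> z0; set h := z / 2; set e := expR h.
  have ez : expR z = e * e by rewrite -expRD -splitr.
  rewrite expRN ez invfM.
  have h0 : 0 <= h by rewrite divr_ge0.
  have e1 : 1 + h <= e by exact: expR_ge1Dx.
  have e0 : 0 < e by exact: expR_gt0.
  have ei : e^-1 <= 1 by rewrite invf_le1 // (le_trans _ e1) // lerDl.
  have he : 0 <= h <= e - e^-1 by rewrite h0 /=; lra.
  have -> : z ^+ 2 / 4 = h ^+ 2 by rewrite /h; field.
  have -> : e * e + e^-1 * e^-1 = 2 + (e - e^-1) ^+ 2 by field; rewrite gt_eqF.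
  by rewrite lerD2l ler_sqr ?nnegrE; lra.
have [/pos//|/ltW y0] := leP 0 y.
by rewrite -sqrrN [leRHS]addrC; have := pos (- y); rewrite opprK; apply; rewrite oppr_ge0.
Qed.

Lemma expR_add_le_norm y : expR y + expR (- y) <= 2 * expR `|y|.
Proof.
by rewrite mulr_natl mulr2n lerD // ler_expR ?ler_norm // -normrN ler_norm.
Qed.

Lemma norm_le_expR_add y : expR `|y| <= expR y + expR (- y).
Proof. by have [_|_] := ger0P y; rewrite ?lerDl ?lerDr expR_ge0. Qed.

Lemma expR_le_inv y : y < 1 -> expR y <= (1 - y)^-1.
Proof.
move=> y1; rewrite -[y in expR y]opprK expRN lef_pV2 ?posrE ?expR_gt0 ?subr_gt0 //.
exact: expR_ge1Dx.
Qed.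

(** For |y| >= 1/2 one has |y| <= 2 y^2; for smaller y the bound e^z <= 1 + z + 2 z^2 is added at
    both signs and the linear terms cancel. *)
Lemma expR_add_le y : expR y + expR (- y) <= 2 * expR (2 * y ^+ 2).
Proof.
have [y2|y2] := leP `|y| (1 / 2); last first.
  apply: le_trans (expR_add_le_norm y) _; rewrite ler_wpM2l // ler_expR.
  by rewrite -real_normK ?num_real //; nra.
have le1 z : `|z| <= 1 / 2 -> expR z <= 1 + z + 2 * z ^+ 2.
  rewrite ler_norml => z2; apply: le_trans (expR_le_inv _) _; first lra.
  rewrite -[_^-1]mul1r ler_pdivrMr; last lra.
  have : 0 <= z ^+ 2 * (1 - 2 * z) by rewrite mulr_ge0 ?sqr_ge0 //; lra.
  by lra.
have := le1 _ y2; have := le1 (- y); rewrite normrN sqrrN => /(_ y2).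
have := expR_ge1Dx (2 * y ^+ 2); lra.
Qed.

Lemma expR_le_affine z : 0 <= z <= 1 -> expR (2 * z) <= 1 + 15 * z.
Proof.
move=> /andP[z0 z1].
have h : expR (z / 2) <= 1 + z.
  apply: le_trans (expR_le_inv _) _; first lra.
  by rewrite -[_^-1]mul1r ler_pdivrMr; nra.
(* The fourth power of e^(z/2) <= 1 + z has coefficients 4 + 6 + 4 + 1 = 15, and each power of z is
   at most z. *)
have -> : 2 * z = 4%:R * (z / 2) by field.
rewrite expRM_natl.
have : expR (z / 2) ^+ 4 <= (1 + z) ^+ 4 by rewrite lerXn2r ?nnegrE ?expR_ge0 //; lra.
move/le_trans; apply.
have z2 : z ^+ 2 <= z by rewrite expr2 ler_piMr.
have z3 : z ^+ 3 <= z by rewrite exprS ler_piMr // exprn_ile1.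
have z4 : z ^+ 4 <= z by rewrite exprS ler_piMr // exprn_ile1.
have -> : (1 + z) ^+ 4 = 1 + 4 * z + 6 * z ^+ 2 + 4 * z ^+ 3 + z ^+ 4 by ring.
lra.
Qed.

End LinearForms.

(** * Exponential moments of truncated variables *)

Section TruncatedLaw.
Variables (R : realType) (S : symlaw R).
Local Notation p := (@sl_p R S).
Local Notation x := (@sl_x R S).
Local Notation neg := (@sl_neg R S).

Lemma expectation_odd_expR (h : S -> R) : (forall v, h (neg v) = - h v) ->
  \sum_v p v * expR (h v) = \sum_v p v * ((expR (h v) + expR (- h v)) / 2).
Proof.
move=> hN; have e : \sum_v p v * expR (h v) = \sum_v p v * expR (- h v).
  rewrite (reindex_inj (inv_inj (@sl_negK R S))).
  by apply: eq_bigr => v _; rewrite hN sl_pN.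
have -> : \sum_v p v * expR (h v) =
    (\sum_v p v * expR (h v) + \sum_v p v * expR (- h v)) / 2 by rewrite -e; field.
rewrite -big_split mulr_suml; apply: eq_bigr => v _ /=.
by rewrite -mulrDr mulrA.
Qed.

(** The lower tail hypothesis [weibull_like] bounds the mass of exactly these windows; the upper end
    2u keeps the exponential moment under control. *)
Definition trunc (u : R) (v : S) : R := if u <= `|x v| <= 2 * u then x v else 0.

Lemma truncN u v : trunc u (neg v) = - trunc u v.
Proof. by rewrite /trunc sl_xN normrN; case: ifP; rewrite ?oppr0. Qed.

Variables (alpha q K : R).
Hypotheses (alpha1 : alpha <= 1) (q_gt0 : 0 < q) (q_le1 : q <= 1).
Hypothesis tailS : weibull_like alpha q K S.
(** The summand 50/q pays for the factor q in the window mass; in the large-b case the 4 covers both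
    the tail cost 2 b^2 and the target 2 b^2. *)
Local Notation L := (4 + 50 / q).

Let Lq : 50 <= q * L.
Proof.
have -> : q * L = 4 * q + 50 by field; rewrite gt_eqF.
by rewrite lerDr mulr_ge0 // ltW.
Qed.

Let L50 : 50 <= L.
Proof. by apply: le_trans Lq _; rewrite ler_piMl // addr_ge0 // divr_ge0 // ltW. Qed.

Let L1 : 4 <= L.
Proof. by rewrite lerDl divr_ge0 // ltW. Qed.

Let L0 : 0 <= L.
Proof. by apply: le_trans L1. Qed.

(* Truncating at the level [Num.max 1 `|b|], which depends on [b], keeps both
   exponential moments between exp(2 b^2) and exp(C b^2) for all sizes of [b],
   although the full exponential moment of a Weibull law is infinite. *)
Lemma truncated_mgf_le b :
  \sum_v p v * expR (2 * L * b * trunc (Num.max 1 `|b|) v) <=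
    expR (32 * L ^+ 2 * b ^+ 2).
Proof.
rewrite expectation_odd_expR => [|v]; last by rewrite truncN mulrN.
have -> : expR (32 * L ^+ 2 * b ^+ 2) = \sum_v p v * expR (32 * L ^+ 2 * b ^+ 2).
  by rewrite -mulr_suml sl_p1 mul1r.
apply: ler_sum => v _.
rewrite ler_wpM2l ?sl_p_ge0 //=.
set y := 2 * L * b * _; rewrite ler_pdivrMr // [leRHS]mulrC.
have [ty|ty] := leP `|b| 1.
  apply: le_trans (expR_add_le _) _; rewrite ler_wpM2l // ler_expR.
  have t2 : trunc (Num.max 1 `|b|) v ^+ 2 <= 4.
    rewrite /trunc max_l //; case: ifP => [/andP[_]|_]; last by rewrite expr0n.
    by rewrite -real_normK ?num_real // => h; have := normr_ge0 (x v); nra.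
  have -> : 2 * y ^+ 2 = 8 * (L ^+ 2 * b ^+ 2) * trunc (Num.max 1 `|b|) v ^+ 2.
    by rewrite /y; ring.
  have : 0 <= L ^+ 2 * b ^+ 2 by rewrite mulr_ge0 ?sqr_ge0.
  by set B := L ^+ 2 * b ^+ 2; rewrite -[32 * _ * _]mulrA -/B; nra.
apply: le_trans (expR_add_le_norm _) _; rewrite ler_wpM2l // ler_expR.
have t2 : `|trunc (Num.max 1 `|b|) v| <= 2 * `|b|.
  rewrite /trunc max_r ?(ltW ty) //; case: ifP => [/andP[]//|_].
  by rewrite normr0 mulr_ge0.
have -> : `|y| = 2 * L * `|b| * `|trunc (Num.max 1 `|b|) v|.
  by rewrite /y !normrM normr_nat (ger0_norm L0).
have : 2 * L * `|b| * `|trunc (Num.max 1 `|b|) v| <= 2 * L * `|b| * (2 * `|b|).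
  by rewrite ler_wpM2l // !mulr_ge0.
move/le_trans; apply; rewrite -[b ^+ 2]real_normK ?num_real //.
have -> : 2 * L * `|b| * (2 * `|b|) = 4 * L * `|b| ^+ 2 by ring.
rewrite ler_wpM2r ?sqr_ge0 // expr2; move: L1; set M := L => M4; nra.
Qed.

Lemma truncated_mgf_ge b : 1 <= K -> `|b| <= K ->
  expR (2 * b ^+ 2) <= \sum_v p v * expR (L * b * trunc (Num.max 1 `|b|) v).
Proof.
move=> K1 bK; rewrite expectation_odd_expR => [|v]; last by rewrite truncN mulrN.
set u := Num.max 1 `|b|; set r := \sum_(v | u <= `|x v| <= 2 * u) p v.
have u1 : 1 <= u by rewrite /u le_max lexx.
have uK : u <= K by rewrite /u ge_max K1.
(* Here alpha <= 1 enters: u^alpha <= u for u >= 1, so the window is at most exponentially rare. *)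
have ru : q * expR (- (2 * u)) <= r.
  have := tailS (u := u); rewrite u1 uK => /(_ isT); apply: le_trans.
  rewrite ler_wpM2l ?(ltW q_gt0) // ler_expR lerN2 ler_wpM2l //.
  by rewrite -[leRHS]powRr1 ?(le_trans _ u1) // ler_powR.
(* Off the window the symmetrized integrand is 1, on it at least [m], and the window has mass
   [r]. *)
have lb (m : R) :
    (forall v, u <= `|x v| <= 2 * u -> 2 * m <= expR (L * b * x v) + expR (- (L * b * x v))) ->
    1 + r * (m - 1) <= \sum_v p v * ((expR (L * b * trunc u v) + expR (- (L * b * trunc u v))) / 2).
  move=> hm; rewrite -{1}(sl_p1 S) /r mulr_suml [X in _ + X]big_mkcond -big_split.
  apply: ler_sum => v _; rewrite /trunc; case: ifPn => /= h.
    rewrite -[X in X + _]mulr1 -mulrDr ler_wpM2l ?sl_p_ge0 //.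
    by have := hm v h; lra.
  rewrite addr0 mulr0 oppr0 expR0 -[leLHS]mulr1 ler_wpM2l ?sl_p_ge0 //; lra.
have r1 : r <= 1.
  rewrite -(sl_p1 S) /r big_mkcond; apply: ler_sum => v _.
  by case: ifP => // _; exact: sl_p_ge0.
(* For |b| <= 1 the quadratic gain r L^2 b^2 / 8 beats 15 b^2, because r >= q/16 and q L^2 >=
   2500. *)
have [b1|b1] := leP `|b| 1.
  have uE : u = 1 by rewrite /u max_l.
  apply: le_trans (lb (1 + L ^+ 2 * b ^+ 2 / 8) _); last first.
    move=> v /andP[]; rewrite uE => xv _; apply: le_trans (expR_add_ge _).
    have : 1 <= x v ^+ 2 by rewrite -real_normK ?num_real //; nra.
    rewrite !exprMn; have : 0 <= L ^+ 2 * b ^+ 2 by rewrite mulr_ge0 ?sqr_ge0.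
    by set B := L ^+ 2 * b ^+ 2; nra.
  have b2 : 0 <= b ^+ 2 <= 1.
    by rewrite sqr_ge0 -real_normK ?num_real //; have := normr_ge0 b; nra.
  apply: le_trans (expR_le_affine b2) _; rewrite lerD2l.
  have e2 : expR 2 <= 16 :> R.
    have -> : 2 = 4%:R * (1 / 2) :> R by field.
    rewrite expRM_natl; have : expR (1 / 2) <= 2 :> R.
      by apply: le_trans (expR_le_inv _) _; first lra; rewrite -[_^-1]mul1r ler_pdivrMr; lra.
    move=> h; apply: le_trans (_ : 2 ^+ 4 <= _); last lra.
    by rewrite lerXn2r ?nnegrE ?expR_ge0.
  have rq : q / 16 <= r.
    apply: le_trans ru; rewrite uE mulr1 expRN ler_wpM2l ?(ltW q_gt0) //.
    by rewrite lef_pV2 ?posrE ?expR_gt0.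
  have -> : r * (1 + L ^+ 2 * b ^+ 2 / 8 - 1) = r * L ^+ 2 / 8 * b ^+ 2 by ring.
  rewrite ler_wpM2r ?sqr_ge0 //.
  have : q / 16 * L ^+ 2 <= r * L ^+ 2 by rewrite ler_wpM2r ?sqr_ge0.
  have : 50 * L <= q * L * L by rewrite ler_wpM2r //; lra.
  have := L50; set M := L => M50; rewrite (_ : q / 16 * M ^+ 2 = q * M * M / 16); last by field.
  lra.
(* For |b| > 1 the integrand on the window is at least exp(L b^2) / 2, which outweighs the small
   mass, at least q exp(- 2 b^2), of the window. *)
have uE : u = `|b| by rewrite /u max_r // ltW.
apply: le_trans (lb (expR (L * b ^+ 2) / 2) _); last first.
  move=> v /andP[]; rewrite uE => xv _; apply: le_trans (norm_le_expR_add _).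
  have -> : 2 * (expR (L * b ^+ 2) / 2) = expR (L * b ^+ 2) by field.
  rewrite ler_expR !normrM (ger0_norm L0).
  rewrite -mulrA ler_wpM2l //.
  by rewrite -real_normK ?num_real // expr2 ler_wpM2l.
have bb : `|b| <= b ^+ 2 by rewrite -[b ^+ 2]real_normK ?num_real //; nra.
have r0 : 0 <= r by apply: sumr_ge0 => v _; apply: sl_p_ge0.
suff : 2 * expR (2 * b ^+ 2) <= r * expR (L * b ^+ 2) by nra.
apply: (@le_trans _ _ (q * expR (- (2 * b ^+ 2)) * expR (L * b ^+ 2))); last first.
  rewrite ler_wpM2r ?expR_ge0 //; apply: le_trans ru.
  by rewrite ler_wpM2l ?(ltW q_gt0) // ler_expR uE lerN2 ler_wpM2l.
rewrite -mulrA -expRD.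
have -> : - (2 * b ^+ 2) + L * b ^+ 2 = 50 / q * b ^+ 2 + 2 * b ^+ 2 by ring.
rewrite expRD mulrA ler_wpM2r ?expR_ge0 //.
have := expR_ge1Dx (50 / q * b ^+ 2).
have : 50 / q * 1 <= 50 / q * b ^+ 2 by rewrite ler_wpM2l ?divr_ge0 ?ltW //; lra.
move=> h1 h2; apply: (@le_trans _ _ (q * (50 / q))); last by rewrite ler_wpM2l ?(ltW q_gt0) //; lra.
by rewrite mulrCA divff ?gt_eqF //; lra.
Qed.

End TruncatedLaw.

Section LinearLowerBound.
Variables (R : realType) (alpha q K : R) (S : symlaw R) (n : nat).
Hypotheses (alpha1 : alpha <= 1) (q_gt0 : 0 < q) (q_le1 : q <= 1).
Hypothesis tailS : weibull_like alpha q K S.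
Local Notation Om := {ffun 'I_n -> S}.
Local Notation x := (@sl_x R S).
Local Notation L := (4 + 50 / q).

(* Paley-Zygmund for the exponential of the truncated form; the truncated and
   the discarded parts are separated by flipping the signs of the latter. *)
Lemma linear_form_ge (c : 'I_n -> R) (h s : R) :
  1 <= s <= K -> 0 < h -> h ^+ 2 <= \sum_j c j ^+ 2 ->
  expR (- (32 * L ^+ 2 * s ^+ 2)) / 8 <=
    Pr (fun w : Om => s * h / L <= `|\sum_j c j * x (w j)|).
Proof.
move=> /andP[s1 sK] h0 hc; have K1 : 1 <= K by exact: le_trans sK.
have s0 : 0 < s by exact: lt_le_trans s1.
have L0 : 0 < L by rewrite ltr_wpDr // divr_ge0 // ltW.
pose N := Num.sqrt (\sum_j c j ^+ 2).
have NE : N ^+ 2 = \sum_j c j ^+ 2 by rewrite sqr_sqrtr // sumr_ge0 // => j _; exact: sqr_ge0.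
have hN : h <= N by rewrite -ler_sqr ?nnegrE ?sqrtr_ge0 ?(ltW h0) // NE.
have N0 : 0 < N by exact: lt_le_trans hN.
(* Normalized so that the squares sum to s^2: the coordinatewise moments multiply to exp(2 s^2) and
   exp(32 L^2 s^2), and |b j| <= s <= K stays in the range of [tailS]. *)
pose b j := s * c j / N; pose u j := Num.max 1 `|b j|.
have b2 : \sum_j b j ^+ 2 = s ^+ 2.
  transitivity (\sum_j s ^+ 2 / N ^+ 2 * c j ^+ 2).
    by apply: eq_bigr => j _; rewrite /b; field; rewrite gt_eqF.
  by rewrite -mulr_sumr -NE; field; rewrite gt_eqF.
have bK j : `|b j| <= K.
  apply: le_trans sK; rewrite -[leRHS]gtr0_norm // -ler_sqr ?nnegrE // !real_normK ?num_real //.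
  by rewrite -b2 (bigD1 j) //= lerDl sumr_ge0 // => i _; exact: sqr_ge0.
pose Z (w : Om) := \sum_j L * b j * trunc (u j) (w j).
pose Y w := expR (Z w).
have EY : expR (2 * s ^+ 2) <= Ex Y.
  have -> : Ex Y = Ex (fun w : Om => \prod_j expR (L * b j * trunc (u j) (w j))).
    by apply: eq_Ex => w; rewrite /Y expR_sum.
  rewrite (Ex_prod (fun j v => expR (L * b j * trunc (u j) v))) -b2 mulr_sumr expR_sum.
  apply: ler_prod => j _; rewrite expR_ge0 /=.
  exact: truncated_mgf_ge tailS _ _ _.
have EY2 : Ex (fun w => Y w ^+ 2) <= expR (32 * L ^+ 2 * s ^+ 2).
  have -> : Ex (fun w => Y w ^+ 2) = Ex (fun w : Om => \prod_j expR (2 * L * b j * trunc (u j) (w j))).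
    apply: eq_Ex => w; rewrite /Y -expRM_natl mulr_sumr expR_sum.
    by apply: eq_bigr => j _; rewrite !mulrA.
  rewrite (Ex_prod (fun j v => expR (2 * L * b j * trunc (u j) v))) -b2 mulr_sumr expR_sum.
  apply: ler_prod => j _; rewrite truncated_mgf_le // andbT sumr_ge0 // => v _.
  by rewrite mulr_ge0 ?sl_p_ge0 ?expR_ge0.
have EY0 : 0 < Ex Y by apply: lt_le_trans EY; exact: expR_gt0.
have := paley_zygmund EY0 (expR_gt0 _) EY2.
have s2 : 1 <= s ^+ 2 by rewrite expr2; nra.
(* Turns the Paley-Zygmund event into [s ^+ 2 <= Z w]; the factor 2 is absorbed because s >= 1. *)
have half : expR (s ^+ 2) <= Ex Y / 2.
  rewrite ler_pdivlMr //; apply: le_trans EY.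
  rewrite mulr_natl mulr2n expRD ler_wpM2l ?expR_ge0 //.
  by apply: le_trans (expR_ge1Dx _); lra.
move=> PZ; pose T (w : Om) := \sum_j c j * trunc (u j) (w j).
have ZT w : Z w = L * s / N * T w.
  by rewrite /T mulr_sumr; apply: eq_bigr => j _; rewrite /b; field; rewrite !gt_eqF.
have PT : expR (- (32 * L ^+ 2 * s ^+ 2)) / 4 <= Pr (fun w : Om => s * h / L <= T w).
  apply: le_trans (_ : Ex Y ^+ 2 / (4 * expR (32 * L ^+ 2 * s ^+ 2)) <= _).
    rewrite expRN -invfM [_ * 4]mulrC -[leLHS]mul1r ler_pM2r; last first.
      by rewrite invr_gt0 mulr_gt0 // expR_gt0.
    rewrite exprn_ege1 //; apply: le_trans EY.
    by rewrite -expR0 ler_expR mulr_ge0 ?sqr_ge0.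
  apply: le_trans PZ _; apply: Pr_le => w /(le_trans half).
  rewrite /Y ler_expR ZT => st; apply: (@le_trans _ _ (s * N / L)).
    by rewrite ler_pM2r ?invr_gt0 // ler_pM2l.
  rewrite -(ler_pM2l (_ : 0 < L * s / N)); last by rewrite divr_gt0 // mulr_gt0.
  rewrite (_ : L * s / N * (s * N / L) = s ^+ 2) //.
  by move: (lt0r_neq0 L0); set M := L => M0; field; rewrite M0 gt_eqF.
rewrite -(ler_pM2l (ltr0n _ 2)).
apply: le_trans (_ : expR (- (32 * L ^+ 2 * s ^+ 2)) / 4 <= _).
  by set E := expR _; rewrite le_eqVlt; apply/orP; left; apply/eqP; field.
apply: le_trans PT _.
pose b' (j : 'I_n) (v : S) := ~~ (u j <= `|x v| <= 2 * u j).
apply: (@Pr_flip _ _ _ b').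
  by move=> j v; rewrite /b' sl_xN normrN.
move=> w tw.
have sumE : \sum_j c j * x (w j) + \sum_j c j * x (flip b' w j) = 2 * T w.
  rewrite -big_split mulr_sumr; apply: eq_bigr => j _ /=.
  rewrite ffunE /b' /trunc; case: ifP => /= h'.
    by rewrite (negPf h') sl_xN; ring.
  by rewrite (negbFE h'); ring.
have [//|h1] := leP (s * h / L) `|\sum_j c j * x (w j)|.
rewrite orFb; have := ler_norm (\sum_j c j * x (w j)).
have := ler_norm (\sum_j c j * x (flip b' w j)).
lra.
Qed.

End LinearLowerBound.

(** * Decoupling *)

Section Decoupling.
Variables (R : realType) (S : symlaw R) (n : nat).
Local Notation Om := {ffun 'I_n -> S}.
Local Notation x := (@sl_x R S).

Definition quad (a : 'I_n -> 'I_n -> R) (w : Om) : R :=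
  \sum_i \sum_j a i j * x (w i) * x (w j).

(** The j-th coefficient of the linear form left when the first argument of the bilinear form is
    frozen. *)
Definition partial_form (M : 'I_n -> 'I_n -> R) (w : Om) (j : 'I_n) : R :=
  \sum_i M i j * x (w i).

(* Tail of the bilinear form evaluated at two independent copies. *)
Definition bilinear_tail (M : 'I_n -> 'I_n -> R) (t : R) : R :=
  Ex (fun w : Om => Pr (fun w' : Om => t <= `|\sum_j partial_form M w j * x (w' j)|)).

Definition cross (I : {set 'I_n}) (a : 'I_n -> 'I_n -> R) (i j : 'I_n) : R :=
  if (i \in I) && (j \notin I) then a i j else 0.

(* Flipping the signs of the coordinates in [I] changes the quadratic form by
   four times its [I] x [~: I] part, whatever the centring [m]. *)
Lemma decoupling (I : {set 'I_n}) (a : 'I_n -> 'I_n -> R) (t m : R) :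
  (forall i j, a i j = a j i) ->
  bilinear_tail (cross I a) (t / 2) <= 2 * Pr (fun w : Om => t <= `|quad a w - m|).
Proof.
move=> asym.
pose B (w : Om) := \sum_j partial_form (cross I a) w j * x (w j).
have -> : bilinear_tail (cross I a) (t / 2) = Pr (fun w : Om => t / 2 <= `|B w|).
  rewrite /Pr -(Ex_glue I); apply: eq_Ex => w; apply: eq_Ex => w'.
  suff -> : B (glue I w w') = \sum_j partial_form (cross I a) w j * x (w' j) by [].
  apply: eq_bigr => j _.
  rewrite /partial_form !mulr_suml; apply: eq_bigr => i _.
  by rewrite !ffunE /cross; case: (i \in I); case: (j \in I); rewrite ?mul0r.
apply: (@Pr_flip _ _ _ (fun j _ => j \in I)) => // w.
set w' := flip _ w => tB.
have xw' i : x (w' i) = (if i \in I then -1 else 1) * x (w i).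
  by rewrite ffunE; case: ifP; rewrite ?sl_xN ?mulN1r ?mul1r.
have qB : quad a w - quad a w' = 4 * B w.
  have BE : B w = \sum_i \sum_j cross I a i j * x (w i) * x (w j).
    rewrite exchange_big; apply: eq_bigr => j _.
    by rewrite /partial_form mulr_suml.
  have BE' : B w = \sum_i \sum_j cross I a j i * x (w i) * x (w j).
    rewrite BE exchange_big; apply: eq_bigr => j _; apply: eq_bigr => i _.
    by rewrite mulrAC.
  (* Both off-diagonal blocks change sign, each contributing 2 B because [a] is symmetric; the
     blocks inside [I] and inside [~: I] cancel. *)
  have -> : 4 * B w = 2 * B w + 2 * B w by ring.
  rewrite {1}BE BE' /quad -sumrB !mulr_sumr -big_split; apply: eq_bigr => i _.
  rewrite -sumrB !mulr_sumr -big_split; apply: eq_bigr => j _ /=.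
  by rewrite !xw' /cross (asym j i); case: (i \in I); case: (j \in I) => /=; ring.
have [//|h] := leP t `|quad a w - m|; rewrite orFb.
have : `|4 * B w| <= `|quad a w - m| + `|quad a w' - m|.
  have -> : 4 * B w = (quad a w - m) - (quad a w' - m) by rewrite -qB; ring.
  exact: ler_normB.
rewrite normrM normr_nat; lra.
Qed.

End Decoupling.

(** * Conditioning on the first copy *)

Section BilinearTails.
Variables (R : realType) (q : R).
Hypotheses (q_gt0 : 0 < q) (q_le1 : q <= 1).
Local Notation L := (4 + 50 / q).

Let L_ge4 : 4 <= L.
Proof. by rewrite lerDl divr_ge0 // ltW. Qed.

Lemma tail_ge (alpha K : R) (S : symlaw R) (n : nat) (i : 'I_n) u :
  weibull_like alpha q K S -> 1 <= u <= K ->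
  q * expR (- (2 * u `^ alpha)) <=
    Pr (fun w : {ffun 'I_n -> S} => u <= `|sl_x (w i)|).
Proof.
move=> tS uK; apply: le_trans (tS u uK) _.
rewrite -(Pr_marginal i (fun v : S => u <= `|sl_x v| <= 2 * u)).
by apply: Pr_le => w /andP[].
Qed.

Section FixedLaw.
Variables (alpha K : R) (S : symlaw R) (n : nat).
Hypotheses (alpha1 : alpha <= 1) (tailS : weibull_like alpha q K S).
Variable M : 'I_n -> 'I_n -> R.
Local Notation Om := {ffun 'I_n -> S}.

(** Given a first copy whose coefficient vector has norm at least [h], the form is linear and
    [linear_form_ge] applies; independence multiplies the two probabilities. *)
Lemma bilinear_tail_ge (h s t e : R) : 1 <= s <= K -> 0 < h -> t <= s * h / L ->
  e <= Pr (fun w : Om => h ^+ 2 <= \sum_j partial_form M w j ^+ 2) ->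
  e * (expR (- (32 * L ^+ 2 * s ^+ 2)) / 8) <= bilinear_tail S M t.
Proof.
move=> sK h0 tsh eP; set E := expR _ / 8.
have E0 : 0 <= E by rewrite divr_ge0 ?expR_ge0.
apply: (@le_trans _ _ (E * Pr (fun w : Om => h ^+ 2 <= \sum_j partial_form M w j ^+ 2))).
  by rewrite mulrC ler_wpM2l.
rewrite -ExZ; apply: le_Ex => w; case: (leP (h ^+ 2) _) => hw /=; last first.
  by rewrite mulr0n mulr0 Pr_ge0.
rewrite mulr1n mulr1.
apply: le_trans (linear_form_ge alpha1 q_gt0 q_le1 tailS sK h0 hw) _.
by apply: Pr_le => w' /(le_trans tsh).
Qed.

End FixedLaw.

End BilinearTails.

(** * The four regimes for a bilinear form *)

Section FourRegimes.
Variables (R : realType) (q : R).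
Hypotheses (q_gt0 : 0 < q) (q_le1 : q <= 1).
Local Notation L := (4 + 50 / q).

Let L_ge4 : 4 <= L.
Proof. by rewrite lerDl divr_ge0 // ltW. Qed.

Let L_gt0 : 0 < L.
Proof. by apply: lt_le_trans L_ge4. Qed.

(** By [linear_form_ge] at s = 1, each coefficient reaches its column norm over L with probability
    at least c'. [reverse_markov] for the weighted count [W] of such columns makes the whole
    coefficient vector of order F with fixed probability; then s is of order t/F. In all four
    regimes the condition on [K] keeps the levels in the range of [weibull_like]. *)
Lemma bilinear_tail_frobenius : exists C c : R, 0 < C /\ 0 < c /\
  forall (alpha K : R) (S : symlaw R) (n : nat) (M : 'I_n -> 'I_n -> R) (F t : R),
    alpha <= 1 -> weibull_like alpha q K S ->
    0 < F -> F ^+ 2 <= \sum_j \sum_i M i j ^+ 2 ->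
    0 <= t -> 1 + c * (t / F) <= K ->
    C * expR (- (c * (t / F) ^+ 2)) <= bilinear_tail S M t.
Proof.
move: L_ge4 L_gt0 (@linear_form_ge R) (@bilinear_tail_ge R q q_gt0 q_le1).
set l := L => l4 l0 LF BT.
(* [c'] is the chance of one column, [g] what [reverse_markov] leaves of it, and [b] is tuned so
   that s = b t / F gives exactly s h / l = t. *)
pose c' : R := expR (- (32 * l ^+ 2)) / 8; pose g := c' / 2; pose b := l ^+ 2 / Num.sqrt g.
have c'0 : 0 < c' by rewrite divr_gt0 ?expR_gt0.
have g0 : 0 < g by rewrite divr_gt0.
have sg0 : 0 < Num.sqrt g by rewrite sqrtr_gt0.
have b0 : 0 < b by rewrite divr_gt0 // exprn_gt0.
have D0 : 0 < 32 * l ^+ 2 by rewrite mulr_gt0 // exprn_gt0.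
exists (g * (expR (- (32 * l ^+ 2)) / 8)), (32 * l ^+ 2 * b ^+ 2 + b); split.
  by rewrite mulr_gt0.
split; first by rewrite addr_gt0 // mulr_gt0 // exprn_gt0.
move=> alpha K S n M F t alpha1 tS F0 FM t0 tK.
have r0 : 0 <= t / F by rewrite divr_ge0 // ltW.
set r := t / F in r0 tK *.
pose s := Num.max 1 (b * r).
have sK : s <= K.
  apply: le_trans tK; rewrite ge_max lerDl mulr_ge0 //=; last by rewrite addr_ge0 ?mulr_ge0 ?sqr_ge0 // ltW.
  rewrite mulrDl addrA ler_wpDl // addr_ge0 // mulr_ge0 // mulr_ge0 ?sqr_ge0 //; exact: ltW.
have s1 : 1 <= s by rewrite le_max lexx.
have sb : b * r <= s by rewrite le_max lexx orbT.
have K1 : 1 <= K by exact: le_trans sK.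
have s2 : s ^+ 2 <= 1 + b ^+ 2 * r ^+ 2.
  rewrite /s; case: (leP 1 (b * r)) => _; last by rewrite expr1n lerDl -exprMn sqr_ge0.
  by rewrite exprMn lerDr.
pose h := F * Num.sqrt g / l.
have h0 : 0 < h by rewrite divr_gt0 // mulr_gt0.
have th : t <= s * h / l.
  have -> : t = b * r * h / l.
    by rewrite /b /r /h; field; rewrite !gt_eqF.
  by rewrite ler_pM2r ?invr_gt0 // ler_pM2r.
pose m j := \sum_i M i j ^+ 2.
have m0 j : 0 <= m j by apply: sumr_ge0 => i _; exact: sqr_ge0.
pose F2 := \sum_j m j.
have F20 : 0 < F2 by apply: lt_le_trans FM; rewrite exprn_gt0.
pose W (w : {ffun 'I_n -> S}) := \sum_j m j * (m j / l ^+ 2 <= partial_form M w j ^+ 2)%R%:R.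
have Pj j : c' <= Pr (fun w : {ffun 'I_n -> S} => m j / l ^+ 2 <= partial_form M w j ^+ 2).
  (* [linear_form_ge] requires a positive norm; for a zero column the event is the whole space. *)
  have [mj|mj] := eqVneq (m j) 0.
    apply: (@le_trans _ _ 1); last first.
      by rewrite -[leLHS](@Ex_cst R S n); apply: le_Ex => w; rewrite mj mul0r sqr_ge0.
    rewrite ler_pdivrMr // mul1r (@le_trans _ _ 1) ?ler1n //.
    by rewrite -[leRHS]expR0 ler_expR oppr_le0 ltW.
  have {}mj : 0 < m j by rewrite lt_def mj m0.
  have := LF alpha q K S n alpha1 q_gt0 q_le1 tS (fun i => M i j) (Num.sqrt (m j)) 1.
  rewrite lexx K1 sqrtr_gt0 mj sqr_sqrtr // => /(_ isT isT (lexx _)).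
  rewrite expr1n mulr1 mul1r -/l => H; apply: le_trans H _.
  apply: Pr_le => w; rewrite -/(partial_form M w j) => H.
  have : (Num.sqrt (m j) / l) ^+ 2 <= `|partial_form M w j| ^+ 2.
    by rewrite ler_sqr ?nnegrE // divr_ge0 ?sqrtr_ge0 // ltW.
  by rewrite real_normK ?num_real // expr_div_n sqr_sqrtr.
have EW : c' * F2 <= Ex W.
  rewrite /W Ex_sum mulr_sumr; apply: ler_sum => j _.
  rewrite ExZ mulrC; apply: ler_wpM2l; [exact: m0 | exact: Pj].
have WF w : W w <= F2.
  by apply: ler_sum => j _; rewrite -[leRHS]mulr1 ler_wpM2l ?m0 // lern1 leq_b1.
have := reverse_markov F20 (ltW c'0) WF EW; rewrite -/g => PW.
have := BT alpha K S n alpha1 tS M h s t g; rewrite s1 sK => /(_ isT h0 th).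
have gP : g <= Pr (fun w : {ffun 'I_n -> S} => h ^+ 2 <= \sum_j partial_form M w j ^+ 2).
  apply: le_trans PW _; apply: Pr_le => w gW.
  apply: (@le_trans _ _ (W w / l ^+ 2)).
    have -> : h ^+ 2 = g * F ^+ 2 / l ^+ 2.
      by rewrite /h expr_div_n exprMn sqr_sqrtr ?ltW // [F ^+ 2 * g]mulrC.
    rewrite ler_pM2r ?invr_gt0 ?exprn_gt0 //; apply: le_trans gW.
    by rewrite ler_pM2l.
  rewrite /W mulr_suml; apply: ler_sum => j _.
  case: (leP (m j / l ^+ 2) _) => [|_]; first by rewrite mulr1n mulr1.
  by rewrite mulr0n mulr0 mul0r sqr_ge0.
move=> /(_ gP); apply: le_trans; rewrite -mulrA ler_pM2l // [leLHS]mulrAC.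
rewrite ler_pM2r ?invr_gt0 // -expRD ler_expR -opprD lerN2.
have : 32 * l ^+ 2 * s ^+ 2 <= 32 * l ^+ 2 * (1 + b ^+ 2 * r ^+ 2) by rewrite ler_pM2l.
have : 0 <= b * r ^+ 2 by rewrite mulr_ge0 ?sqr_ge0 // ltW.
lra.
Qed.

(** The norm of the coefficient vector dominates its product with [y], a linear form with
    coefficients M y. Both factors are thus Gaussian tails, taken at one level s with s^2 of order t
    / sigma. *)
Lemma bilinear_tail_spectral : exists C c : R, 0 < C /\ 0 < c /\
  forall (alpha K : R) (S : symlaw R) (n : nat) (M : 'I_n -> 'I_n -> R)
    (y : 'I_n -> R) (sigma t : R),
    alpha <= 1 -> weibull_like alpha q K S ->
    0 < sigma -> \sum_j y j ^+ 2 <= 1 ->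
    sigma ^+ 2 <= \sum_i (\sum_j M i j * y j) ^+ 2 ->
    0 <= t -> 1 + c * (t / sigma) <= K ->
    C * expR (- (c * (t / sigma))) <= bilinear_tail S M t.
Proof.
move: L_ge4 L_gt0 (@linear_form_ge R) (@bilinear_tail_ge R q q_gt0 q_le1).
set l := L => l4 l0 LF BT.
have D0 : 0 < 32 * l ^+ 2 by rewrite mulr_gt0 // exprn_gt0.
have l2 : 1 <= l ^+ 2 by rewrite exprn_ege1 //; lra.
exists ((expR (- (32 * l ^+ 2)) / 8) ^+ 2), (2 * (32 * l ^+ 2) * l ^+ 2); split.
  by rewrite exprn_gt0 // divr_gt0 // expR_gt0.
split; first by rewrite !mulr_gt0 // exprn_gt0.
move=> alpha K S n M y sg t alpha1 tS sg0 y1 sM t0 tK.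
have r0 : 0 <= t / sg by rewrite divr_ge0 // ltW.
set r := t / sg in r0 tK *.
(* Each of the two uses of [linear_form_ge] gains s and loses l, hence s^2 >= l^2 t / sigma. *)
pose v := Num.max 1 (l ^+ 2 * r); pose s := Num.sqrt v.
have v1 : 1 <= v by rewrite le_max lexx.
have v0 : 0 <= v by exact: le_trans v1.
have vr : l ^+ 2 * r <= v by rewrite le_max lexx orbT.
have vr' : v <= 1 + l ^+ 2 * r.
  by rewrite ge_max lerDl lerDr ler01 mulr_ge0 // (le_trans _ l2).
have sv : s ^+ 2 = v by rewrite sqr_sqrtr.
have s1 : 1 <= s by rewrite -[leLHS]sqrtr1 ler_sqrt // ltr01.
have s0 : 0 < s by exact: lt_le_trans s1.
have sK : s <= K.
  apply: le_trans tK; apply: (@le_trans _ _ v); first by rewrite -sv expr2 ler_peMl // ltW.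
  apply: le_trans vr' _; rewrite lerD2l ler_wpM2r //.
  by rewrite ler_peMl ?(le_trans _ l2) //; nra.
pose h := sg * s / l.
have h0 : 0 < h by rewrite divr_gt0 // mulr_gt0.
have th : t <= s * h / l.
  have -> : s * h / l = v * (sg / l ^+ 2) by rewrite -sv /h; field; rewrite gt_eqF.
  have -> : t = l ^+ 2 * r * (sg / l ^+ 2) by rewrite /r; field; rewrite !gt_eqF.
  by rewrite ler_pM2r // divr_gt0 // exprn_gt0.
have sK' : 1 <= s <= K by rewrite s1 sK.
have := BT alpha K S n alpha1 tS M h s t (expR (- (32 * l ^+ 2 * s ^+ 2)) / 8) sK' h0 th.
have P : expR (- (32 * l ^+ 2 * s ^+ 2)) / 8 <=
    Pr (fun w : {ffun 'I_n -> S} => h ^+ 2 <= \sum_j partial_form M w j ^+ 2).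
  have := LF alpha q K S n alpha1 q_gt0 q_le1 tS (fun i => \sum_j M i j * y j) sg s sK' sg0 sM.
  rewrite -/l => H; apply: le_trans H _; apply: Pr_le => w.
  have -> : \sum_i (\sum_j M i j * y j) * sl_x (w i) = \sum_j y j * partial_form M w j.
    under eq_bigr do rewrite mulr_suml.
    rewrite exchange_big; apply: eq_bigr => j _; rewrite mulr_sumr.
    by apply: eq_bigr => i _; rewrite mulrAC mulrC.
  rewrite [s * sg]mulrC -/h => H.
  have : h ^+ 2 <= `|\sum_j y j * partial_form M w j| ^+ 2.
    by rewrite ler_sqr ?nnegrE // ltW.
  move/le_trans; apply; rewrite real_normK ?num_real //.
  set Z := \sum_j _; set W := \sum_j _.
  have W0 : 0 <= W by apply: sumr_ge0 => j _; exact: sqr_ge0.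
  (* Cauchy-Schwarz, from 0 <= sum_j (W_j - Z y_j)^2 and |y| <= 1 *)
  have : 0 <= \sum_j (partial_form M w j - Z * y j) ^+ 2.
    by apply: sumr_ge0 => j _; exact: sqr_ge0.
  have -> : \sum_j (partial_form M w j - Z * y j) ^+ 2 =
      W - 2 * Z * Z + Z ^+ 2 * \sum_j y j ^+ 2.
    have -> : 2 * Z * Z = \sum_j 2 * Z * (y j * partial_form M w j) by rewrite -mulr_sumr.
    rewrite mulr_sumr -sumrB -big_split; apply: eq_bigr => j _ /=; ring.
  have : Z ^+ 2 * \sum_j y j ^+ 2 <= Z ^+ 2 * 1 by rewrite ler_wpM2l ?sqr_ge0.
  rewrite expr2; lra.
move=> /(_ P); apply: le_trans.
rewrite -[leRHS]expr2 !expr_div_n -!expRM_natl mulrAC -expRD.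
rewrite ler_pM2r ?invr_gt0 ?exprn_gt0 // ler_expR sv.
have : 32 * l ^+ 2 * v <= 32 * l ^+ 2 * (1 + l ^+ 2 * r) by rewrite ler_pM2l.
lra.
Qed.

End FourRegimes.

Section SingleRow.
Variables (R : realType) (q : R).
Hypotheses (q_gt0 : 0 < q) (q_le1 : q <= 1).
Local Notation L := (4 + 50 / q).

Lemma partial_form_row (S : symlaw R) n (M : 'I_n -> 'I_n -> R) (i0 : 'I_n) w j :
  (forall i j, i != i0 -> M i j = 0) ->
  partial_form (S := S) M w j = M i0 j * sl_x (w i0).
Proof.
move=> Mrow; rewrite /partial_form (bigD1 i0) //= big1 ?addr0 // => i ii.
by rewrite Mrow // mul0r.
Qed.

Lemma max1_powR_le (l r b : R) : 1 <= l -> 0 <= r -> 0 <= b <= 1 ->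
  Num.max 1 (l * r) `^ b <= 1 + l * r `^ b.
Proof.
move=> l1 r0 /andP[b0 b1]; have l0 : 0 <= l by exact: le_trans l1.
case: (leP 1 (l * r)) => _; last by rewrite powR1 lerDl mulr_ge0 ?powR_ge0.
rewrite powRM // ler_wpDl // ler_wpM2r ?powR_ge0 //.
by rewrite -[leRHS]powRr1 // ler_powR.
Qed.

(** Asking |x_{i0}| >= u costs u^alpha and the remaining linear form at level s costs s^2, subject
    to u s = v of order t/r. Equalizing the costs gives u = v^(2/(2+alpha)) and s =
    v^(alpha/(2+alpha)), whence the exponent. *)
Lemma bilinear_tail_row : exists C c : R, 0 < C /\ 0 < c /\
  forall (alpha K : R) (S : symlaw R) (n : nat) (M : 'I_n -> 'I_n -> R)
    (i0 : 'I_n) (r t : R),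
    0 < alpha -> alpha <= 1 -> weibull_like alpha q K S ->
    (forall i j, i != i0 -> M i j = 0) ->
    0 < r -> r ^+ 2 <= \sum_j M i0 j ^+ 2 ->
    0 <= t -> 1 + c * (t / r) <= K ->
    C * expR (- (c * (t / r) `^ (2 * alpha / (2 + alpha)))) <= bilinear_tail S M t.
Proof.
have : 4 <= L by rewrite lerDl divr_ge0 // ltW.
move: (@bilinear_tail_ge R q q_gt0 q_le1); set l := L => BT l4.
have l0 : 0 < l by apply: lt_le_trans l4.
have l1 : 1 <= l by lra.
pose D := 2 + 32 * l ^+ 2.
have D1 : 1 <= D by rewrite /D; have := sqr_ge0 l; lra.
have D0 : 0 < D by exact: lt_le_trans D1.
exists (q * expR (- D) / 8), (D * l); split; first by rewrite divr_gt0 // mulr_gt0 // expR_gt0.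
split; first by rewrite mulr_gt0.
move=> alpha K S n M i0 r t a0 a1 tS Mrow r0 rM t0 tK.
have rho0 : 0 <= t / r by rewrite divr_ge0 // ltW.
set rho := t / r in rho0 tK *; set beta := 2 * alpha / (2 + alpha).
have A0 : 0 < 2 + alpha by rewrite addr_gt0.
pose v := Num.max 1 (l * rho).
have v1 : 1 <= v by rewrite le_max lexx.
have v0 : 0 <= v by exact: le_trans v1.
have vK : v <= K.
  apply: le_trans tK; rewrite ge_max lerDl mulr_ge0 //=; last by rewrite mulr_ge0 // ltW.
  by rewrite ler_wpDl // -mulrA ler_peMl // mulr_ge0 // ltW.
pose u := v `^ (2 / (2 + alpha)); pose s := v `^ (alpha / (2 + alpha)).
have us : u * s = v.
  rewrite -powRD; last by rewrite (gt_eqF (lt_le_trans ltr01 v1)) implybT.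
  by rewrite -mulrDl divff ?powRr1 // gt_eqF.
have lev e : 0 <= e <= 1 -> 1 <= v `^ e <= v.
  move=> /andP[e0 e1]; apply/andP; split.
    by rewrite -[leLHS](powRr0 v) ler_powR.
  by rewrite -[leRHS]powRr1 // ler_powR.
have /andP[u1 uv] : 1 <= u <= v.
  by apply: lev; rewrite divr_ge0 ?(ltW A0) ?(ltW a0) //= ler_pdivrMr //; lra.
have /andP[s1 sv] : 1 <= s <= v.
  by apply: lev; rewrite divr_ge0 ?(ltW A0) ?(ltW a0) //= ler_pdivrMr //; lra.
have ua : u `^ alpha = v `^ beta.
  by rewrite -powRrM /beta; congr (_ `^ _); rewrite mulrAC.
have s2 : s ^+ 2 = v `^ beta.
  rewrite /s -(powR_mulrn 2 (powR_ge0 v _)) -powRrM /beta; congr (_ `^ _).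
  by rewrite mulrAC [alpha * _]mulrC.
have vb : v `^ beta <= 1 + l * rho `^ beta.
  apply: max1_powR_le => //; rewrite divr_ge0 ?mulr_ge0 ?(ltW A0) ?(ltW a0) //=.
  by rewrite ler_pdivrMr //; lra.
have u0 : 0 < u by exact: lt_le_trans u1.
have := BT alpha K S n a1 tS M (u * r) s t (q * expR (- (2 * u `^ alpha))).
rewrite s1 (le_trans sv vK) mulr_gt0 // => /(_ isT isT).
have th : t <= s * (u * r) / l.
  have -> : s * (u * r) / l = v * (r / l) by rewrite -us; field; rewrite gt_eqF.
  have -> : t = l * rho * (r / l) by rewrite /rho; field; rewrite !gt_eqF.
  by rewrite ler_pM2r ?divr_gt0 // le_max lexx orbT.
have eP : q * expR (- (2 * u `^ alpha)) <=
    Pr (fun w : {ffun 'I_n -> S} => (u * r) ^+ 2 <= \sum_j partial_form M w j ^+ 2).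
  have uK : 1 <= u <= K by rewrite u1 (le_trans uv).
  apply: le_trans (tail_ge i0 tS uK) _; apply: Pr_le => w ux.
  have -> : \sum_j partial_form M w j ^+ 2 = `|sl_x (w i0)| ^+ 2 * \sum_j M i0 j ^+ 2.
    rewrite mulr_sumr; apply: eq_bigr => j _.
    by rewrite (partial_form_row _ _ Mrow) real_normK ?num_real // exprMn mulrC.
  by rewrite exprMn ler_pM ?sqr_ge0 // ler_sqr ?nnegrE // ltW.
move=> /(_ th eP); apply: le_trans.
rewrite [leLHS]mulrAC [leRHS]mulrA ler_pM2r ?invr_gt0 //.
rewrite -!mulrA ler_pM2l // -!expRD ler_expR ua s2.
have : D * v `^ beta <= D * (1 + l * rho `^ beta) by rewrite ler_pM2l.
by rewrite /D; lra.
Qed.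

(** Both variables of the chosen entry are made as large as sqrt(t/r), at a cost of order
    (t/r)^(alpha/2) each. *)
Lemma bilinear_tail_entry : exists C c : R, 0 < C /\ 0 < c /\
  forall (alpha K : R) (S : symlaw R) (n : nat) (M : 'I_n -> 'I_n -> R)
    (i0 j0 : 'I_n) (r t : R),
    0 < alpha -> alpha <= 1 -> weibull_like alpha q K S ->
    (forall i j, i != i0 -> M i j = 0) ->
    0 < r -> r <= `|M i0 j0| ->
    0 <= t -> 1 + c * (t / r) <= K ->
    C * expR (- (c * (t / r) `^ (alpha / 2))) <= bilinear_tail S M t.
Proof.
exists (q ^+ 2 * expR (- 4) / 2), 4; split.
  by rewrite divr_gt0 // mulr_gt0 ?expR_gt0 // exprn_gt0.
split=> // alpha K S n M i0 j0 r t a0 a1 tS Mrow r0 rM t0 tK.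
have rho0 : 0 <= t / r by rewrite divr_ge0 // ltW.
set rho := t / r in rho0 tK *.
(* The factor 1 matches the shape of [max1_powR_le]. *)
pose v := Num.max 1 (1 * rho).
have v1 : 1 <= v by rewrite le_max lexx.
have v0 : 0 <= v by exact: le_trans v1.
have vK : v <= K by apply: le_trans tK; rewrite ge_max; lra.
pose u := v `^ (2^-1).
have uu : u * u = v by rewrite -expr2 /u powR12_sqrt // sqr_sqrtr.
have u1 : 1 <= u by rewrite -[leLHS](powRr0 v) ler_powR // invr_ge0.
have uv : u <= v by rewrite -uu ler_peMl // (le_trans _ u1).
have u0 : 0 < u by exact: lt_le_trans u1.
have ua : u `^ alpha <= 1 + rho `^ (alpha / 2).
  rewrite -powRrM mulrC -[rho `^ _]mul1r; apply: max1_powR_le => //.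
  by rewrite divr_ge0 ?(ltW a0) //=; lra.
have uK : 1 <= u <= K by rewrite u1 (le_trans uv).
set e := q * expR (- (2 * u `^ alpha)).
have e0 : 0 <= e by rewrite mulr_ge0 ?expR_ge0 // ltW.
have tail i : e <= Pr (fun w : {ffun 'I_n -> S} => u <= `|sl_x (w i)|).
  exact: tail_ge tS uK.
have : e / 2 * e <= bilinear_tail S M t.
  apply: (@le_trans _ _ (e / 2 * Pr (fun w : {ffun 'I_n -> S} => u <= `|sl_x (w i0)|))).
    by rewrite ler_wpM2l // divr_ge0.
  rewrite -ExZ; apply: le_Ex => w; case: (leP u _) => uw /=; last first.
    by rewrite mulr0n mulr0 Pr_ge0.
  rewrite mulr1n mulr1 ler_pdivrMr // mulrC.
  apply: le_trans (tail j0) _.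
  (* Flipping every coordinate but [j0] leaves the single term at [j0] as the average of the two
     linear forms, so one of them is at least as large. *)
  apply: (@Pr_flip _ _ _ (fun j _ => j != j0)) => // w' uw'.
  set w'' := flip _ w'; pose Z (w1 : {ffun 'I_n -> S}) := \sum_j partial_form M w j * sl_x (w1 j).
  have ZZ : Z w' + Z w'' = 2 * (partial_form M w j0 * sl_x (w' j0)).
    rewrite -big_split (bigD1 j0) //= big1 => [|j jj].
      by rewrite addr0 ffunE eqxx; ring.
    by rewrite ffunE jj sl_xN; ring.
  have big : t <= `|partial_form M w j0 * sl_x (w' j0)|.
    rewrite (partial_form_row _ _ Mrow) !normrM.
    have -> : t = rho * r by rewrite /rho divfK // gt_eqF.
    apply: (@le_trans _ _ (r * u * u)).
      by rewrite -mulrA uu mulrC ler_pM2l // le_max mul1r lexx orbT.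
    by rewrite ler_pM ?mulr_ge0 ?(ltW r0) ?(ltW u0) // ler_pM ?(ltW r0) ?(ltW u0).
  have [//|h] := leP t `|\sum_j partial_form M w j * sl_x (w' j)|; rewrite orFb.
  have : `|Z w' + Z w''| <= `|Z w'| + `|Z w''| by exact: ler_normD.
  rewrite ZZ normrM normr_nat; move: h; rewrite -/(Z w') -/(Z w''); lra.
apply: le_trans.
have -> : e / 2 * e = q ^+ 2 * (expR (- (2 * u `^ alpha)) * expR (- (2 * u `^ alpha))) / 2.
  by rewrite /e; field.
rewrite [leLHS]mulrAC ler_pM2r ?invr_gt0 // -mulrA ler_pM2l ?exprn_gt0 //.
rewrite -!expRD ler_expR; lra.
Qed.

End SingleRow.

(** * Choice of the decoupling set *)

Section CrossBlocks.
Variables (R : realType) (n : nat).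

(* A pair i <> j satisfies i \in I and j \notin I for a quarter of the sets I. *)
Lemma exists_cross (b : 'I_n -> 'I_n -> R) : (forall i, b i i = 0) ->
  exists I : {set 'I_n},
    (\sum_i \sum_j b i j) / 4 <= \sum_i \sum_j cross I b i j.
Proof.
move=> b0.
(* Toggling one index is an involution on sets; it makes membership of i a fair coin, independent of
   membership of any j other than i. *)
pose tog (i : 'I_n) (I : {set 'I_n}) := if i \in I then I :\ i else i |: I.
have togE i I k : (k \in tog i I) = (if k == i then i \notin I else k \in I).
  rewrite /tog; case: ifP => iI; rewrite ?inE; case: eqP => //= _.
have togK i : involutive (tog i).
  move=> I; apply/setP => k; rewrite !togE.
  by case: eqP => [->|//]; rewrite eqxx negbK.
pose N : R := \sum_(I : {set 'I_n}) 1.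
have half j : \sum_(I : {set 'I_n}) (j \notin I)%:R = N / 2.
  have e : \sum_(I : {set 'I_n}) (j \notin I)%:R = \sum_(I : {set 'I_n}) (j \in I)%:R :> R.
    rewrite (reindex_inj (inv_inj (togK j))); apply: eq_bigr => I _.
    by rewrite togE eqxx negbK.
  have -> : N = \sum_(I : {set 'I_n}) (j \notin I)%:R + \sum_(I : {set 'I_n}) (j \in I)%:R.
    by rewrite -big_split; apply: eq_bigr => I _; case: (j \in I); rewrite /= ?add0r ?addr0.
  by rewrite -e; field.
have quarter i j : i != j ->
    \sum_(I : {set 'I_n}) ((i \in I) && (j \notin I))%:R = N / 4 :> R.
  move=> ij.
  have e : \sum_(I : {set 'I_n}) ((i \in I) && (j \notin I))%:R =
      \sum_(I : {set 'I_n}) ((i \notin I) && (j \notin I))%:R :> R.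
    rewrite (reindex_inj (inv_inj (togK i))); apply: eq_bigr => I _.
    by rewrite !togE eqxx [j == i]eq_sym (negPf ij).
  have -> : N / 4 = (N / 2) / 2 by field.
  have -> : N / 2 = \sum_(I : {set 'I_n}) ((i \in I) && (j \notin I))%:R +
      \sum_(I : {set 'I_n}) ((i \notin I) && (j \notin I))%:R.
    rewrite -(half j) -big_split; apply: eq_bigr => I _.
    by case: (i \in I); rewrite /= ?add0r ?addr0.
  by rewrite -e; field.
apply: contrapT => /forallNP nI.
pose T (I : {set 'I_n}) := \sum_i \sum_j cross I b i j.
set s := (\sum_i \sum_j b i j) / 4 in nI.
have lt I : T I < s by rewrite ltNge; apply/negP; exact: nI.
have sumT : \sum_I T I = N * s.
  rewrite exchange_big /= /s mulrC -mulrA mulrC mulr_sumr; apply: eq_bigr => i _.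
  rewrite exchange_big /= mulr_sumr; apply: eq_bigr => j _.
  have [->|ij] := eqVneq i j.
    by rewrite b0 mulr0 big1 // => I _; rewrite /cross b0 if_same.
  rewrite [_^-1 * N]mulrC -(quarter _ _ ij) mulr_suml; apply: eq_bigr => I _.
  by rewrite /cross; case: ifP; rewrite ?mul1r ?mul0r.
have ge0 I : true -> 0 <= s - T I by rewrite subr_ge0 ltW.
have sum0 : \sum_I (s - T I) = 0.
  rewrite sumrB sumT /N mulr_suml; under eq_bigr do rewrite -[s]mul1r.
  by rewrite subrr.
(* If every block fell short, nonnegative deficits would sum to zero and vanish, against strictness
   at the empty set. *)
have /eqP := psumr_eq0P ge0 sum0 (i := finset.set0) isT.
by rewrite subr_eq0 gt_eqF.
Qed.

End CrossBlocks.

(** * Tails of the quadratic form for finitely supported laws *)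

Section FiniteTails.
Variables (R : realType) (q : R).
Hypotheses (q_gt0 : 0 < q) (q_le1 : q <= 1).

Definition matrix_form (S : symlaw R) n (A : 'M[R]_n) : {ffun 'I_n -> S} -> R :=
  quad (fun i j => A i j).

(** Common shape of the four bounds, with norm [nu] and rate [phi]. The constants are chosen before
    the law, the dimension and the centring [m]. *)
Definition finite_tail (nu : forall n, 'M[R]_n -> R) (phi : R -> R -> R) : Prop :=
  exists C c : R, 0 < C /\ 0 < c /\
  forall (alpha K : R) (S : symlaw R) (n : nat) (A : 'M[R]_n) (t m : R),
    (0 < n)%N -> 0 < alpha -> alpha <= 1 -> weibull_like alpha q K S ->
    A^T = A -> (forall i, A i i = 0) -> 0 < nu n A -> 0 <= t ->
    1 + c * (t / nu n A) <= K ->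
    C * expR (- (c * phi alpha (t / nu n A))) <=
      Pr (fun w : {ffun 'I_n -> S} => t <= `|matrix_form A w - m|).

Lemma matrix_form_tail (S : symlaw R) n (A : 'M[R]_n) (I : {set 'I_n}) (t m e : R) :
  A^T = A -> e <= bilinear_tail S (cross I (fun i j => A i j)) (t / 2) ->
  e / 2 <= Pr (fun w : {ffun 'I_n -> S} => t <= `|matrix_form A w - m|).
Proof.
move=> AT eB; rewrite ler_pdivrMr // mulrC; apply: le_trans eB _.
by apply: decoupling => i j; rewrite -[in LHS]AT mxE.
Qed.

(** [exists_cross] for the squared entries keeps half of the Frobenius norm, which compensates
    exactly for the level t/2 in [decoupling]. *)
Lemma finite_tail_frobenius :
  finite_tail (@frobenius_norm R) (fun _ rho => rho ^+ 2).
Proof.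
have [C [c [C0 [c0 H]]]] := bilinear_tail_frobenius q_gt0 q_le1.
exists (C / 2), c; split; first by rewrite divr_gt0.
split=> // alpha K S n A t m n0 a0 a1 tS AT A0 F0 t0 tK.
have [|I FI] := @exists_cross R n (fun i j => A i j ^+ 2).
  by move=> i; rewrite A0 expr0n.
set F := frobenius_norm A in F0 tK *.
have F2 : F ^+ 2 = \sum_i \sum_j A i j ^+ 2.
  by rewrite sqr_sqrtr // sumr_ge0 // => i _; apply: sumr_ge0 => j _; exact: sqr_ge0.
rewrite mulrAC; apply: (matrix_form_tail (I := I)) => //.
have e : t / F = t / 2 / (F / 2) by field; rewrite gt_eqF.
rewrite e; apply: (H alpha K) => //.
- by rewrite divr_gt0.
- rewrite expr_div_n F2 -[2 ^+ 2]natrX (le_trans FI) // exchange_big /=.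
  rewrite le_eqVlt; apply/orP; left; apply/eqP.
  apply: eq_bigr => j _; apply: eq_bigr => i _.
  by rewrite /cross; case: ifP => //; rewrite expr0n.
- by rewrite divr_ge0.
- by rewrite -e.
Qed.

(** For a near-maximizer x and z = A x, a good block M satisfies <z, M x> >= |z|^2 / 4, hence |M x|
    >= |z| / 4 >= sg / 8. *)
Lemma finite_tail_spectral :
  finite_tail (@spectral_norm R) (fun _ rho => rho).
Proof.
have [C [c [C0 [c0 H]]]] := bilinear_tail_spectral q_gt0 q_le1.
exists (C / 2), (c * 4); split; first by rewrite divr_gt0.
split; first by rewrite mulr_gt0.
move=> alpha K S n A t m n0 a0 a1 tS AT A0 s0 t0 tK.
set sg := spectral_norm A in s0 tK *.
have [_ [x x1 <-] sx] : exists2 r, [set l2norm (A *m x) | x in [set x : 'cV[R]_n | l2norm x <= 1]] r & sg - sg / 2 < r.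
  apply: sup_adherent; first by rewrite divr_gt0.
  (* [sup] is 0 when no supremum exists, which positivity of the norm rules out. *)
  apply: contrapT => /sup_out; rewrite -/(spectral_norm A) -/sg => s00.
  by rewrite s00 ltxx in s0.
pose z i := (A *m x) i 0.
have zE i : z i = \sum_j A i j * x j 0 by rewrite /z mxE.
have z2 : (sg / 2) ^+ 2 <= \sum_i z i ^+ 2.
  have zs : 0 <= \sum_i z i ^+ 2 by apply: sumr_ge0 => i _; exact: sqr_ge0.
  rewrite -(sqr_sqrtr zs) ler_sqr ?nnegrE ?sqrtr_ge0 //; last by rewrite divr_ge0 // ltW.
  by apply: ltW; apply: le_lt_trans sx; lra.
(* [exists_cross] allows signed entries; these sum to |z|^2. *)
have [|I bI] := @exists_cross R n (fun i j => z i * (A i j * x j 0)).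
  by move=> i; rewrite A0 mul0r mulr0.
set M := cross I (fun i j => A i j).
pose g i := \sum_j M i j * x j 0.
have zg : (\sum_i z i ^+ 2) / 4 <= \sum_i z i * g i.
  have -> : \sum_i z i ^+ 2 = \sum_i \sum_j z i * (A i j * x j 0).
    by apply: eq_bigr => i _; rewrite -mulr_sumr -zE.
  apply: le_trans bI _; rewrite le_eqVlt; apply/orP; left; apply/eqP.
  apply: eq_bigr => i _; rewrite mulr_sumr; apply: eq_bigr => j _.
  by rewrite /M /cross; case: ifP => // _; rewrite mul0r mulr0.
have g2 : (sg / 8) ^+ 2 <= \sum_i g i ^+ 2.
  have : 0 <= \sum_i (g i - z i / 4) ^+ 2 by apply: sumr_ge0 => i _; exact: sqr_ge0.
  have -> : \sum_i (g i - z i / 4) ^+ 2 =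
      \sum_i g i ^+ 2 - (\sum_i z i * g i) / 2 + (\sum_i z i ^+ 2) / 16.
    rewrite !mulr_suml -sumrB -big_split; apply: eq_bigr => i _ /=.
    by field.
  have -> : (sg / 8) ^+ 2 = (sg / 2) ^+ 2 / 16 by field.
  lra.
rewrite mulrAC; apply: (matrix_form_tail (I := I)) => //.
have e : c * 4 * (t / sg) = c * (t / 2 / (sg / 8)) by field; rewrite gt_eqF.
rewrite e; apply: (H alpha K S n M (fun j => x j 0)) => //.
- by rewrite divr_gt0.
- rewrite -[leRHS](expr1n _ 2); rewrite -[leLHS]sqr_sqrtr.
    by rewrite ler_sqr ?nnegrE ?sqrtr_ge0.
  by apply: sumr_ge0 => j _; exact: sqr_ge0.
- by rewrite divr_ge0.
- by rewrite -e.
Qed.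

Lemma l2_linfty_norm_row n (A : 'M[R]_n) : (0 < n)%N ->
  exists i, l2_linfty_norm A = Num.sqrt (\sum_j A i j ^+ 2).
Proof.
move=> n0; rewrite /l2_linfty_norm (bigmax_eq_arg _ (Ordinal n0)) //.
by eexists.
Qed.

(** Cutting out a single index keeps its whole row: the only entry removed is the diagonal one,
    which vanishes. *)
Lemma cross_row n (A : 'M[R]_n) (i0 j : 'I_n) : A i0 i0 = 0 ->
  cross [set i0]%SET (fun i j => A i j) i0 j = A i0 j.
Proof.
by move=> A0; rewrite /cross !inE eqxx /=; case: eqP => // ->.
Qed.

Lemma finite_tail_row :
  finite_tail (@l2_linfty_norm R)
    (fun alpha rho => rho `^ (2 * alpha / (2 + alpha))).
Proof.
have [C [c [C0 [c0 H]]]] := bilinear_tail_row q_gt0 q_le1.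
exists (C / 2), c; split; first by rewrite divr_gt0.
split=> // alpha K S n A t m n0 a0 a1 tS AT A0 r0 t0 tK.
have [i0 rE] := l2_linfty_norm_row A n0; move: r0 tK; rewrite rE.
set r := Num.sqrt _ => r0 tK.
have tr : t / 2 / r <= t / r by rewrite ler_pM2r ?invr_gt0 //; lra.
have tr0 : 0 <= t / 2 / r by rewrite !divr_ge0 // ltW.
rewrite mulrAC; apply: (matrix_form_tail (I := [set i0]%SET)) => //.
apply: le_trans (H alpha K S n _ i0 r (t / 2) a0 a1 tS _ r0 _ _ _).
- rewrite ler_pM2l // ler_expR lerN2 ler_pM2l //.
  have th0 : 0 <= 2 * alpha / (2 + alpha).
    by rewrite divr_ge0 ?mulr_ge0 ?addr_ge0 // ltW.
  by apply: (ge0_ler_powR th0 _ _ tr); rewrite nnegrE // (le_trans tr0).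
- by move=> i j ii; rewrite /cross inE (negPf ii).
- rewrite /r sqr_sqrtr; last by apply: sumr_ge0 => j _; exact: sqr_ge0.
  by apply: ler_sum => j _; rewrite cross_row.
- by rewrite divr_ge0.
- by apply: le_trans tK; rewrite lerD2l ler_pM2l.
Qed.

Lemma finite_tail_entry :
  finite_tail (fun n => @mx_norm R n n) (fun alpha rho => rho `^ (alpha / 2)).
Proof.
have [C [c [C0 [c0 H]]]] := bilinear_tail_entry q_gt0.
exists (C / 2), c; split; first by rewrite divr_gt0.
split=> // alpha K S n A t m n0 a0 a1 tS AT A0 r0 t0 tK.
have [[i0 j0] /= rE] := mx_norm_neq0 (lt0r_neq0 r0); move: r0 tK; rewrite rE.
set r := `|_| => r0 tK.
have tr : t / 2 / r <= t / r by rewrite ler_pM2r ?invr_gt0 //; lra.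
have tr0 : 0 <= t / 2 / r by rewrite !divr_ge0 // ltW.
rewrite mulrAC; apply: (matrix_form_tail (I := [set i0]%SET)) => //.
apply: le_trans (H alpha K S n _ i0 j0 r (t / 2) a0 a1 tS _ r0 _ _ _).
- rewrite ler_pM2l // ler_expR lerN2 ler_pM2l //.
  have th0 : 0 <= alpha / 2 by rewrite divr_ge0 // ltW.
  by apply: (ge0_ler_powR th0 _ _ tr); rewrite nnegrE // (le_trans tr0).
- by move=> i j ii; rewrite /cross inE (negPf ii).
- by rewrite cross_row.
- by rewrite divr_ge0.
- by apply: le_trans tK; rewrite lerD2l ler_pM2l.
Qed.

End FiniteTails.

(** * Discretization *)

Lemma measure_finite_classes d (T : measurableType d) (R : realType)
    (mu : {measure set T -> \bar R}) (V : finType) (f : T -> V) (E : pred V) :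
  (forall v, measurable (f @^-1` [set v])) ->
  measurable [set y | E (f y)] /\
  mu [set y | E (f y)] = (\sum_(v | E v) mu (f @^-1` [set v]))%E.
Proof.
move=> fm; have -> : [set y | E (f y)] = \bigcup_(v in [set` enum E]) (f @^-1` [set v]).
  apply/seteqP; split => [y Ey|y [v]] /=.
    by exists (f y) => //=; rewrite mem_enum.
  by rewrite mem_enum => Ev ->.
split; first by apply: fin_bigcup_measurable => //; exact: finite_seq.
rewrite measure_fin_bigcup //; last by move=> v w _ _ [y [/= <- <-]].
by rewrite -fsbig_seq ?enum_uniq // big_enum; apply: eq_bigl.
Qed.

Section Discretization.
Variable R : realType.
Variables (N L : nat).
Hypothesis N_gt0 : (0 < N)%N.

Definition grid (k : nat) : R := k%:R / N%:R.

(* Number of points of the grid [1/N, ..., L/N] that lie strictly below |y|. *)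
Definition level (y : R) : nat := find (fun k => `|y| <= grid k.+1) (iota 0 L).

Lemma grid_le (k k' : nat) : (k <= k')%N -> grid k <= grid k'.
Proof. by move=> kk; rewrite ler_pM2r ?invr_gt0 ?ltr0n // ler_nat. Qed.

Lemma level_le y : (level y <= L)%N.
Proof. by rewrite -[leqRHS](size_iota 0) find_size. Qed.

Lemma levelN y : level (- y) = level y.
Proof. by rewrite /level; apply: eq_find => k; rewrite normrN. Qed.

Lemma level_lt y : (level y < L)%N -> `|y| <= grid (level y).+1.
Proof.
move=> yL; have hyp : has (fun k => `|y| <= grid k.+1) (iota 0 L).
  by rewrite has_find size_iota.
by have := nth_find 0 hyp; rewrite nth_iota // add0n.
Qed.

(** Levels become strict tail events, the form in which the Weibull law is given. *)
Lemma level_ge k y : (0 < k <= L)%N -> (k <= level y)%N = (grid k < `|y|).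
Proof.
move=> /andP[k0 kL]; apply/idP/idP => [ky|ky].
  have kn : (k.-1 < level y)%N by rewrite prednK.
  have := before_find 0 kn.
  rewrite nth_iota ?add0n ?prednK // => /negbT; first by rewrite -ltNge.
rewrite leqNgt; apply/negP => yk.
have := level_lt (leq_trans yk kL); rewrite leNgt.
by rewrite (le_lt_trans (grid_le yk) ky).
Qed.

Lemma grid_level y : grid (level y) <= `|y|.
Proof.
have [->|l0] := posnP (level y); first by rewrite /grid mul0r.
by apply: ltW; rewrite -level_ge ?leqnn // l0 level_le.
Qed.

Lemma measurable_level_ge k : measurable [set y : R | (k <= level y)%N].
Proof.
have [->|k0] := posnP k.
  rewrite (_ : [set _ | _] = setT); first exact: measurableT.
  by apply/seteqP; split.
have [kL|Lk] := leqP k L; last first.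
  rewrite (_ : [set _ | _] = set0); first exact: measurable0.
  apply/seteqP; split => // y /= ky.
  by have := leq_trans (leq_trans Lk ky) (level_le y); rewrite ltnn.
rewrite (_ : [set _ | _] = `]-oo, (- grid k)[ `|` `]grid k, +oo[).
  by apply: measurableU; exact: measurable_itv.
apply/seteqP; split => y /=; rewrite !in_itv /= andbT level_ge ?k0 //.
  by rewrite lter_normr; case/orP => h; [right|left; rewrite ltrNr].
by rewrite lter_normr => -[h|h]; apply/orP; [right; rewrite ltrNr|left].
Qed.

Definition class := ('I_L.+1 * bool)%type.

(* Rounding towards zero: with two classes of level 0 the second one is empty,
   which makes [classify] exactly equivariant under [y |-> - y]. *)
Definition classify (y : R) : class :=
  (inord (level y), (y < 0) && (0 < level y)%N).

Definition class_neg (v : class) : class :=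
  (v.1, if v.1 == 0%N :> nat then v.2 else ~~ v.2).

Definition class_val (v : class) : R := (-1) ^+ v.2 * grid v.1.

Lemma classify1 y : (classify y).1 = level y :> nat.
Proof. by rewrite inordK // ltnS level_le. Qed.

Lemma class_negK : involutive class_neg.
Proof. by case=> k b; rewrite /class_neg /=; case: eqP => //= _; rewrite negbK. Qed.

Lemma class_valN v : class_val (class_neg v) = - class_val v.
Proof.
case: v => k b; rewrite /class_val /class_neg /=.
case: eqP => [->|_]; first by rewrite /grid mul0r !mulr0 oppr0.
by rewrite signrN mulNr.
Qed.

Lemma classifyN y : classify (- y) = class_neg (classify y).
Proof.
rewrite /class_neg classify1 /classify levelN /=; congr (_, _).
case: eqP => [->|/eqP]; rewrite ?ltnn ?andbF // -lt0n => l0.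
rewrite l0 !andbT oppr_lt0 -leNgt le_eqVlt; case: eqP => // y0.
move: l0; rewrite -y0 => /[dup] l1.
rewrite level_ge ?(leq_trans l1 (level_le _)) // normr0 ltNge /grid.
by rewrite divr_ge0.
Qed.

Lemma classify_near y : (level y < L)%N ->
  `|y - class_val (classify y)| <= N%:R^-1.
Proof.
move=> yL; have := level_lt yL; have := grid_level y.
rewrite /class_val classify1 /=.
have gS : grid (level y).+1 = grid (level y) + N%:R^-1.
  by rewrite /grid -natr1 mulrDl mul1r.
have Ni : 0 <= N%:R^-1 :> R by rewrite invr_ge0.
rewrite gS; have [y0|y0] := ltP y 0 => /=; last first.
  rewrite expr0 mul1r (ger0_norm y0) => h1 h2; rewrite ler_norml; lra.
have [->|l0] := posnP (level y).
  by rewrite /grid mul0r mulr0 subr0 add0r.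
rewrite /= expr1 mulN1r opprK (ltr0_norm y0) => h1 h2.
by rewrite ler_norml; lra.
Qed.

Lemma class_val_norm y : `|class_val (classify y)| = grid (level y).
Proof.
rewrite /class_val normrMsign classify1 ger0_norm //.
by rewrite /grid divr_ge0.
Qed.

Lemma measurable_class v : measurable (classify @^-1` [set v]).
Proof.
case: v => k b.
pose lv := [set y : R | (k <= level y)%N] `\` [set y | (k.+1 <= level y)%N].
have mlv : measurable lv by apply: measurableD; exact: measurable_level_ge.
have lvE y : lv y <-> level y = k.
  rewrite /lv /=; split => [[h1 /negP]|->]; last by split => //; rewrite ltnn.
  by rewrite -leqNgt => h2; apply/eqP; rewrite eqn_leq h1 h2.
have mlv0 : measurable [set y : R | (1 <= level y)%N] by exact: measurable_level_ge.
have m0 : measurable [set y : R | y < 0].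
  rewrite (_ : [set _ | _] = [set` `]-oo, (0 : R)[]); first exact: measurable_itv.
  by rewrite set_itvE.
have mb : measurable [set y : R | (y < 0) && (0 < level y)%N].
  rewrite (_ : [set _ | _] = [set y : R | y < 0] `&` [set y : R | (1 <= level y)%N]).
    exact: measurableI.
  by apply/seteqP; split => y /=; [move/andP|move=> h; apply/andP].
rewrite (_ : _ @^-1` _ = lv `&`
    (if b then [set y : R | (y < 0) && (0 < level y)%N]
     else ~` [set y : R | (y < 0) && (0 < level y)%N])).
  by apply: measurableI => //; case: (b) => //; exact: measurableC.
apply/seteqP; split => y /=.
  move=> yk.
  have kE : level y = k by rewrite -classify1 yk.
  have bE : (y < 0) && (0 < level y)%N = b by move: yk; rewrite /classify => -[].
  by split; [apply/lvE | rewrite -bE; case: ifP => // /negbT /negP].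
move=> [/lvE yk bb]; rewrite /classify; congr (_, _).
  by apply/val_inj; rewrite /= inordK ?yk.
by move: bb; case: (b) => // /negP /negbTE.
Qed.

End Discretization.

(** * The discretized Weibull law *)

Section DiscreteWeibull.
Variables (R : realType) (alpha : R) (N J : nat).
Hypotheses (alpha_gt0 : 0 < alpha) (N_gt1 : (1 < N)%N).
Local Notation L := (J * N)%N.
Local Notation cell v := (@classify R N L @^-1` [set v]).

Let N_gt0 : (0 < N)%N.
Proof. exact: ltn_trans N_gt1. Qed.

Let Ni : 0 < N%:R^-1 :> R.
Proof. by rewrite invr_gt0 ltr0n. Qed.

Definition level_prob (k : nat) : R :=
  if k == 0%N then 1 else if (k <= L)%N then expR (- (grid R N k `^ alpha)) else 0.

(** At level 0 the whole mass sits on the sign bit [false], in agreement with [classify]. *)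
Definition class_prob (v : class L) : R :=
  let l := level_prob v.1 - level_prob v.1.+1 in
  if v.1 == 0%N :> nat then (if v.2 then 0 else l) else l / 2.

Lemma class_prob_neg v : class_prob (class_neg v) = class_prob v.
Proof. by case: v => k b; rewrite /class_prob /class_neg /=; case: eqP. Qed.

Section Law.
Variable mu : probability R R.
Hypothesis mu_weibull : symmetric_weibull alpha mu.

Lemma mu_level_ge k :
  mu [set y | (k <= level N L y)%N] = (level_prob k)%:E.
Proof.
rewrite /level_prob; case: posnP => [->|k0].
  by rewrite (_ : [set _ | _] = setT) ?probability_setT //; apply/seteqP; split.
case: leqP => kL; last first.
  rewrite (_ : [set _ | _] = set0) ?measure0 //; apply/seteqP; split => // y /= ky.
  by have := leq_trans kL (leq_trans ky (level_le N L y)); rewrite ltnn.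
rewrite -mu_weibull.2; last by rewrite /grid divr_ge0.
by congr (mu _); apply/seteqP; split => y /=; rewrite level_ge ?k0.
Qed.

Let mu_setD (A B : set R) : measurable A -> measurable B ->
  mu (A `\` B) = (mu A - mu (A `&` B))%E.
Proof.
move=> mA mB; apply: measureD => //.
by apply: le_lt_trans (probability_le1 _ _) (ltry 1).
Qed.

Lemma mu_cell v : mu (cell v) = (class_prob v)%:E.
Proof.
case: v => k b.
have mlv j : measurable [set y : R | (j <= level N L y)%N] by exact: measurable_level_ge.
have lev : mu [set y | level N L y = k] = (level_prob k - level_prob k.+1)%:E.
  have -> : [set y : R | level N L y = k] =
      [set y | (k <= level N L y)%N] `\` [set y | (k.+1 <= level N L y)%N].
    apply/seteqP; split => y /=; first by move=> ->; split => //; rewrite ltnn.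
    by move=> [h1 /negP]; rewrite -leqNgt => h2; apply/eqP; rewrite eqn_leq h1 h2.
  rewrite mu_setD; [|exact: mlv..].
  rewrite (_ : _ `&` _ = [set y | (k < level N L y)%N]) ?mu_level_ge //.
  by apply/seteqP; split => y /= => [[]//|h]; split => //; exact: ltnW.
have levE : mu [set y | level N L y = k] = (mu (cell (k, true)) + mu (cell (k, false)))%E.
  rewrite -measureU; [congr (mu _)|exact: measurable_class..|].
    apply/seteqP; split => y /= => [yk|].
      case e : (classify N L y) => [k' b']; have : k' = k.
        by apply/val_inj; rewrite /= -yk -(classify1 N L y) e.
      by move=> ->; case: b' {e}; [left|right].
    by rewrite -(classify1 N L y) => -[] ->.
  by apply/seteqP; split => y //= [-> //].
rewrite /class_prob /=; case: posnP => [k0|k0].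
  have c0 : cell (k, true) = set0.
    apply/seteqP; split => y //= yk.
    have := classify1 N L y; rewrite yk /= k0 => l0.
    by move: yk; rewrite /classify -l0 ltnn andbF => -[].
  by case: b; rewrite ?c0 ?measure0 // -lev levE c0 measure0 add0e.
(* Symmetry of [mu] splits a positive level evenly between its two signs. *)
have sym : mu (cell (k, true)) = mu (cell (k, false)).
  rewrite -[RHS]mu_weibull.1; last exact: measurable_class.
  congr (mu _); apply/seteqP; split => y /=; rewrite classifyN //.
    by move=> ->; rewrite /class_neg /= (gtn_eqF k0).
  move=> e; rewrite -[classify N L y]class_negK e /class_neg /=.
  by rewrite (gtn_eqF k0).
have fin : mu (cell (k, false)) \is a fin_num.
  by apply: fin_num_measure; exact: measurable_class.
have : mu (cell (k, b)) = mu (cell (k, false)) by case: (b); rewrite ?sym.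
move=> ->; rewrite -(fineK fin); congr (_%:E).
move: levE; rewrite lev sym -(fineK fin) -EFinD => -[->].
by field.
Qed.

Lemma sum_class_prob (E : pred (class L)) :
  mu [set y | E (classify N L y)] = (\sum_(v | E v) class_prob v)%:E.
Proof.
have [_ ->] := measure_finite_classes mu E (@measurable_class R N L N_gt0).
by rewrite -sumEFin; apply: eq_bigr => v _; exact: mu_cell.
Qed.

Lemma class_prob_ge0 v : 0 <= class_prob v.
Proof. by rewrite -lee_fin -mu_cell measure_ge0. Qed.

Lemma class_prob1 : \sum_v class_prob v = 1.
Proof.
apply: EFin_inj; rewrite -(sum_class_prob predT).
by rewrite (_ : [set _ | _] = setT) ?probability_setT //; apply/seteqP; split.
Qed.

Definition discrete_weibull : symlaw R :=
  SymLaw class_prob_ge0 class_prob1 (@class_negK L) class_prob_neg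
    (@class_valN R N L).

(** Rounding lowers |y| by at most 1/N <= u/2, so (3u/2, 2u] lands in [u, 2u]. With x = (3u/2)^alpha
    its mass is exp(- x) - exp(- (4/3)^alpha x); x >= 1 yields the constant and x <= 2 u^alpha the
    exponent. *)
Lemma discrete_weibull_like K : alpha <= 1 -> K <= J%:R ->
  weibull_like alpha (1 - expR (- ((4 / 3) `^ alpha - 1))) K discrete_weibull.
Proof.
move=> alpha1 KJ u /andP[u1 uK].
have u0 : 0 < u by exact: lt_le_trans u1.
have N2 : N%:R^-1 <= 1 / 2 :> R.
  by rewrite div1r lef_pV2 ?posrE ?ltr0n // ler_nat.
rewrite -lee_fin -(sum_class_prob (fun v => u <= `|class_val R N v| <= 2 * u)).
set G := [set y | _].
have mG : measurable G.
  by have [] := measure_finite_classes mu (fun v => u <= `|class_val R N v| <= 2 * u) (@measurable_class R N L N_gt0).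
pose a := 3 / 2 * u; pose A c := [set y : R | c < `|y|].
have mA c : measurable (A c).
  rewrite (_ : A c = [set` `]-oo, (- c)[] `|` [set` `]c, +oo[]).
    by apply: measurableU; exact: measurable_itv.
  apply/seteqP; split => y; rewrite /A /= !in_itv /= andbT lter_normr.
    by case/orP => h; [right|left; rewrite ltrNr].
  by move=> -[h|h]; apply/orP; [right; rewrite ltrNr|left].
have AG : A a `\` A (2 * u) `<=` G.
  move=> y [/= ay /negP]; rewrite -leNgt => yu; rewrite /G /= class_val_norm.
  rewrite (le_trans (grid_level L N_gt0 y) yu) andbT.
  have [lL|] := ltnP (level N L y) L.
    have := level_lt lL; rewrite /grid -natr1 mulrDl mul1r.
    by move: ay; rewrite /A /a /=; lra.
  (* Values past the end of the grid are rounded to J, which is at least K and hence u. *)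
  move=> Ll; apply: le_trans (le_trans uK KJ) _.
  by rewrite /grid ler_pdivlMr ?ltr0n // -natrM ler_nat.
apply: (@le_trans _ _ (mu (A a `\` A (2 * u)))); last first.
  by apply: le_measure => //; rewrite inE //; exact: measurableD.
have AA : A a `&` A (2 * u) = A (2 * u).
  apply/seteqP; split => y /= => [[]//|h]; split => //.
  by apply: lt_trans h; rewrite /a; lra.
have a0 : 0 <= a by rewrite mulr_ge0 ?(ltW u0).
have u20 : 0 <= 2 * u by rewrite mulr_ge0 ?(ltW u0).
rewrite mu_setD // AA.
rewrite !mu_weibull.2 // -EFinB lee_fin.
have p1 : 1 = 1 `^ alpha :> R by rewrite powR1.
set x := a `^ alpha.
have x1 : 1 <= x.
  by rewrite [leLHS]p1 ge0_ler_powR ?nnegrE ?(ltW alpha_gt0) // /a; lra.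
have x2 : x <= 2 * u `^ alpha.
  rewrite /x /a powRM ?(ltW u0) //.
  rewrite ler_wpM2r ?powR_ge0 //; apply: (@le_trans _ _ ((3 / 2) `^ 1)).
    by rewrite ler_powR //; lra.
  by rewrite powRr1; lra.
have -> : (2 * u) `^ alpha = (4 / 3) `^ alpha * x.
  by rewrite /x -powRM ?a0 //; congr (_ `^ _); rewrite /a; field.
have b0 : 0 <= (4 / 3) `^ alpha - 1.
  rewrite subr_ge0 [leLHS]p1 ge0_ler_powR ?nnegrE ?(ltW alpha_gt0) //; lra.
set b := _ `^ alpha - 1 in b0 *.
have -> : - ((4 / 3) `^ alpha * x) = - x + - (b * x) by rewrite /b; ring.
rewrite expRD; set f := expR (- (b * x)).
have -> : expR (- x) - expR (- x) * f = (1 - f) * expR (- x) by ring.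
apply: ler_pM; rewrite ?expR_ge0 ?subr_ge0 //.
- by rewrite -[leRHS]expR0 ler_expR oppr_le0.
- by rewrite lerD2l lerN2 ler_expR lerN2 ler_peMr.
- by rewrite ler_expR lerN2.
Qed.

(** These classes gather the values beyond J, where the rounding error is unbounded. *)
Definition top_class (v : class L) := v.1 == L :> nat.

Lemma top_class_prob : (0 < J)%N ->
  \sum_(v | top_class v) class_prob v <= expR (- (J%:R `^ alpha)).
Proof.
move=> J0; rewrite -lee_fin -(sum_class_prob top_class).
rewrite (_ : [set _ | _] = [set y | (L <= level N L y)%N]); last first.
  apply/seteqP; split => y /=; rewrite /top_class classify1; first by move/eqP ->.
  by move=> h; rewrite eqn_leq level_le h.
have L0 : (0 < L)%N by rewrite muln_gt0 J0.
rewrite mu_level_ge /level_prob leqnn (gtn_eqF L0) lee_fin /grid natrM mulfK //.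
by rewrite pnatr_eq0 -lt0n.
Qed.

End Law.

Lemma nontop_class (y : R) : ~~ top_class (classify N L y) ->
  [/\ `|y| <= J%:R, `|class_val R N (classify N L y)| <= J%:R &
      `|y - class_val R N (classify N L y)| <= N%:R^-1].
Proof.
rewrite /top_class classify1 => lL.
have {}lL : (level N L y < L)%N by rewrite ltn_neqAle lL level_le.
have JE : grid R N L = J%:R by rewrite /grid natrM mulfK // pnatr_eq0 -lt0n.
split; last exact: classify_near.
  by rewrite -JE; apply: le_trans (level_lt lL) (grid_le _ N_gt0 lL).
by rewrite class_val_norm // -JE grid_le // ltnW.
Qed.

End DiscreteWeibull.

(** * Transfer to Weibull variables *)

Lemma quadratic_formE (R : realType) n (A : 'M[R]_n) (x : 'cV[R]_n) :
  quadratic_form A x = \sum_i \sum_j A i j * x i 0 * x j 0.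
Proof.
rewrite /quadratic_form mxE exchange_big; apply: eq_bigr => j _.
rewrite mxE mulr_suml; apply: eq_bigr => i _.
by rewrite !mxE [x i 0 * _]mulrC.
Qed.

Lemma measurable_quadratic_form (R : realType) d (T : measurableType d)
    (P : probability T R) n (eta : 'I_n -> {RV P >-> R}) (A : 'M[R]_n) :
  measurable_fun setT (fun w => quadratic_form A (random_vector eta w)).
Proof.
have -> : (fun w => quadratic_form A (random_vector eta w)) =
    (fun w => \sum_i \sum_j A i j * eta i w * eta j w).
  apply/funext => w; rewrite quadratic_formE.
  by apply: eq_bigr => i _; apply: eq_bigr => j _; rewrite !mxE.
apply: measurable_sum => i; apply: measurable_sum => j.
apply: measurable_realfun.measurable_funM; last exact: measurable_funPT.
by apply: measurable_realfun.measurable_funM; [exact: measurable_cst | exact: measurable_funPT].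
Qed.

Section Transfer.
Variables (R : realType) (alpha : R).
Hypotheses (alpha_gt0 : 0 < alpha) (alpha_le1 : alpha <= 1).
Variables (n : nat) (n_gt0 : (0 < n)%N).
Variables (d : measure_display) (T : measurableType d) (P : probability T R).
Variable eta : 'I_n -> {RV P >-> R}.
Hypothesis indep : mutually_independent eta.
Hypothesis law : forall i, symmetric_weibull alpha (distribution P (eta i)).

(** Cell probabilities depend on [alpha] only, so the law at one index [i0] serves for all
    coordinates. *)
Lemma discretized_law (N J : nat) (N_gt1 : (1 < N)%N) (i0 : 'I_n)
    (E : {ffun 'I_n -> discrete_weibull J N_gt1 (law i0)} -> bool) :
  let f w := [ffun i => classify N (J * N) (eta i w)] in
  measurable [set w | E (f w)] /\ P [set w | E (f w)] = (Pr E)%:E.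
Proof.
move=> f; set S := discrete_weibull _ _ _ in E *.
have N_gt0 : (0 < N)%N by exact: (ltn_trans _ N_gt1).
have fE (v : {ffun 'I_n -> S}) : f @^-1` [set v] =
    \bigcap_(i in [set` [set: 'I_n]%SET]) eta i @^-1` (@classify R N (J * N) @^-1` [set v i]).
  apply/seteqP; split => w /=; first by move=> <- i _ /=; rewrite ffunE.
  by move=> H; apply/ffunP => i; rewrite ffunE; apply: (H i) => /=; rewrite inE.
have mf (v : {ffun 'I_n -> S}) : measurable (f @^-1` [set v]).
  rewrite fE; apply: fin_bigcap_measurable; first exact: finite_finset.
  by move=> i _; apply: measurable_funPTI; exact: measurable_class.
have [mE PE] := measure_finite_classes P E mf; split => //.
rewrite PE.
transitivity (\sum_(v | E v) (\prod_i class_prob alpha (v i))%:E)%E.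
  apply: eq_bigr => v _; rewrite fE.
  apply: etrans (indep [set: 'I_n]%SET
    (B := fun i => @classify R N (J * N) @^-1` [set v i]) _) _.
    by move=> i; exact: measurable_class.
  rewrite -prodEFin; apply: eq_big => [i|i _]; first by rewrite inE.
  exact: (mu_cell N_gt1 (law i)).
rewrite sumEFin /Pr /Ex [in LHS]big_mkcond; congr (_%:E); apply: eq_bigr => v _.
by case: (E v); rewrite ?mulr1 // mulr0.
Qed.

(** The bound [b] is uniform over the discretized laws, so for fixed [t] the grid may be refined
    until the rounding error of the form is at most t, the gap between 2t and t, outside an event of
    probability at most [e]. *)
Lemma transfer (A : 'M[R]_n) (t m K b : R) : 0 < t ->
  (forall S : symlaw R,
     weibull_like alpha (1 - expR (- ((4 / 3) `^ alpha - 1))) K S ->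
     b <= Pr (fun w : {ffun 'I_n -> S} => 2 * t <= `|matrix_form A w - m|)) ->
  (b%:E <= P [set w | (t <= `|quadratic_form A (random_vector eta w) - m|)%R])%E.
Proof.
move=> t0 H; apply/lee_addgt0Pr => e e0.
(* J^alpha >= n/e gives exp(- J^alpha) <= e/n, so a union bound over the n coordinates leaves
   [e]. *)
pose J := (Num.truncn (Num.max K ((n%:R / e) `^ alpha^-1))).+1.
have [KJ eJ] : K <= J%:R /\ n%:R / e <= J%:R `^ alpha.
  have /ltW := truncnS_gt (Num.max K ((n%:R / e) `^ alpha^-1)).
  rewrite ge_max => /andP[KJ eJ]; split=> //.
  have ne0 : 0 <= n%:R / e by rewrite divr_ge0 // ltW.
  have -> : n%:R / e = ((n%:R / e) `^ alpha^-1) `^ alpha.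
    by rewrite -powRrM mulVf ?gt_eqF // powRr1.
  by apply: (ge0_ler_powR (ltW alpha_gt0) _ _ eJ); rewrite nnegrE ?powR_ge0.
pose a := \sum_i \sum_j `|A i j|.
have a0 : 0 <= a by apply: sumr_ge0 => i _; apply: sumr_ge0.
(* Products of two coordinates bounded by J move by at most 2J/N under rounding; the second
   successor ensures N > 1. *)
pose N := (Num.truncn (2 * J%:R * a / t)).+2.
have N1 : (1 < N)%N by [].
have N0 : 0 < N%:R :> R by rewrite ltr0n.
have aN : a * (2 * J%:R / N%:R) <= t.
  rewrite mulrA ler_pdivrMr // [t * _]mulrC -ler_pdivrMr //.
  have /ltW h := truncnS_gt (2 * J%:R * a / t).
  by rewrite [a * _]mulrC (le_trans h) // ler_nat.
pose i0 := Ordinal n_gt0.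
pose S := discrete_weibull J N1 (law i0).
pose f w : {ffun 'I_n -> S} := [ffun i => classify N (J * N) (eta i w)].
pose E1 (v : {ffun 'I_n -> S}) := 2 * t <= `|matrix_form A v - m|.
pose top : pred S := @top_class N J.
pose E3 (v : {ffun 'I_n -> S}) := [exists i, top (v i)].
pose E2 v := E1 v && ~~ E3 v.
have b1 : b <= Pr E1 by apply: H; exact: discrete_weibull_like.
have b12 : Pr E1 <= Pr E2 + Pr E3.
  rewrite -ExD; apply: le_Ex => v; rewrite /E2.
  by case: (E1 v); case: (E3 v); rewrite ?add0r ?addr0.
have b3 : Pr E3 <= e.
  apply: le_trans (Pr_union (E := fun i (v : {ffun 'I_n -> S}) => top (v i)) _) _.
    by move=> v /existsP.
  have topP i : Pr (fun v : {ffun 'I_n -> S} => top (v i)) <= e / n%:R.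
    rewrite (Pr_marginal i top).
    apply: le_trans (top_class_prob N1 (law i0) _) _ => //.
    have nR : 0 < n%:R :> R by rewrite ltr0n.
    have : 0 < J%:R `^ alpha by apply: lt_le_trans eJ; rewrite divr_gt0.
    move=> Ja; rewrite expRN -[e / n%:R]invf_div lef_pV2 ?posrE ?expR_gt0 ?divr_gt0 //.
    by apply: le_trans eJ _; apply: le_trans (expR_ge1Dx _); rewrite lerDr.
  apply: le_trans (ler_sum _ (fun i _ => topP i)) _.
  rewrite sumr_const card_ord -[leLHS]mulr_natr divfK //.
  by rewrite pnatr_eq0 -lt0n.
have [mE2 PE2] := discretized_law E2.
apply: (@le_trans _ _ ((Pr E2)%:E + e%:E)%E).
  by rewrite -EFinD lee_fin; lra.
rewrite leeD2r // -PE2; apply: le_measure; rewrite ?inE //.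
  have mQ := measurable_quadratic_form eta A.
  have mg : measurable_fun setT (fun w => `|quadratic_form A (random_vector eta w) - m|).
    apply: measurableT_comp => //.
    by apply: measurable_realfun.measurable_funB => //; exact: measurable_cst.
  have := mg measurableT _ (@measurable_itv R `[t, +oo[).
  rewrite setTI; congr measurable; apply/seteqP; split => w /=; by rewrite in_itv /= andbT.
move=> w /= /andP[E1w /existsPn ntop].
have QE : quadratic_form A (random_vector eta w) = \sum_i \sum_j A i j * eta i w * eta j w.
  rewrite quadratic_formE.
  by apply: eq_bigr => i _; apply: eq_bigr => j _; rewrite !mxE.
have diff : `|quadratic_form A (random_vector eta w) - matrix_form A (f w)| <= t.
  apply: le_trans aN; rewrite QE /matrix_form /quad -sumrB /a mulr_suml.
  apply: le_trans (ler_norm_sum _ _ _) _; apply: ler_sum => i _.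
  rewrite -sumrB mulr_suml; apply: le_trans (ler_norm_sum _ _ _) _; apply: ler_sum => j _.
  have := ntop i; have := ntop j; rewrite !ffunE => /(nontop_class N1) [yJ xJ yx].
  move=> /(nontop_class N1) [yJ' xJ' yx'].
  move: yJ xJ yx yJ' xJ' yx'; rewrite /=.
  set y := eta j w; set x := class_val _ _ _; set y' := eta i w; set x' := class_val _ _ _.
  move=> yJ xJ yx yJ' xJ' yx'.
  have -> : A i j * y' * y - A i j * x' * x = A i j * (y' * (y - x) + x * (y' - x')) by ring.
  rewrite normrM ler_wpM2l //; apply: le_trans (ler_normD _ _) _.
  rewrite (normrM y' (y - x)) (normrM x (y' - x')).
  have -> : 2 * J%:R / N%:R = J%:R * N%:R^-1 + J%:R * N%:R^-1 :> R by ring.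
  by apply: lerD; apply: ler_pM.
have : `|matrix_form A (f w) - m| <=
    `|quadratic_form A (random_vector eta w) - m| +
    `|quadratic_form A (random_vector eta w) - matrix_form A (f w)|.
  apply: le_trans (ler_normB _ _).
  by rewrite le_eqVlt; apply/orP; left; apply/eqP; congr (`|_|); ring.
by move: E1w; rewrite /E1 -/(f w); lra.
Qed.

End Transfer.

(** * Norms and quotients in the extended reals *)

Section ExtendedQuotients.
Variable R : realType.

Lemma spectral_norm_ge0 n (A : 'M[R]_n) : 0 <= spectral_norm A.
Proof.
rewrite leNgt; apply/negP => s0.
have hs : has_sup [set l2norm (A *m x) | x in [set x : 'cV[R]_n | l2norm x <= 1]].
  apply: contrapT => /sup_out; rewrite -/(spectral_norm A) => s00.
  by rewrite s00 ltxx in s0.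
suff : 0 <= spectral_norm A by rewrite leNgt s0.
apply: (@le_trans _ _ (l2norm (A *m 0))); first exact: sqrtr_ge0.
apply: ub_le_sup; first exact: hs.2.
exists 0 => //=; rewrite /l2norm big1 ?sqrtr0 // => i _.
by rewrite mxE expr0n.
Qed.

Lemma l2_linfty_norm_ge0 n (A : 'M[R]_n) : (0 < n)%N -> 0 <= l2_linfty_norm A.
Proof. by move=> n0; have [i ->] := l2_linfty_norm_row A n0; exact: sqrtr_ge0. Qed.

Lemma mx_norm_ge0 n (A : 'M[R]_n) : 0 <= mx_norm A.
Proof.
by have [->//|/mx_norm_neq0 [i ->]] := eqVneq (mx_norm A) 0; exact: normr_ge0.
Qed.

Lemma ediv0 (t : R) : 0 < t -> (t%:E / 0%:E = +oo)%E.
Proof. by move=> t0; rewrite inver eqxx gt0_muley // lte_fin. Qed.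

Lemma edivE (t nu : R) : nu != 0 -> (t%:E / nu%:E = (t / nu)%:E)%E.
Proof. by move=> nu0; rewrite inver (negPf nu0) EFinM. Qed.

Lemma ediv_ge0 (t nu : R) : 0 <= t -> 0 <= nu -> (0 <= t%:E / nu%:E)%E.
Proof. by move=> t0 nu0; rewrite mule_ge0 ?inve_ge0 ?lee_fin. Qed.

Lemma f2_ge0 (alpha : R) n (A : 'M[R]_n) (t : R) :
  (0 < n)%N -> 0 <= t -> (0 <= f2 alpha A t)%E.
Proof.
move=> n0 t0; rewrite /f2 !le_min expe_ge0 ?poweR_ge0 ?ediv_ge0 ?sqrtr_ge0 //.
exact: spectral_norm_ge0.
Qed.

End ExtendedQuotients.

(** [K] is fixed after t, as [transfer] accepts any range; the doubling bound on [phi] absorbs the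
    passage from t to 2t. *)
Lemma real_tail (R : realType) (alpha q : R) (nu : forall n, 'M[R]_n -> R)
    (phi : R -> R -> R) : 0 < alpha -> alpha <= 1 ->
  q = 1 - expR (- ((4 / 3) `^ alpha - 1)) ->
  (forall rho, 0 <= rho -> phi alpha (2 * rho) <= 4 * phi alpha rho) ->
  finite_tail q nu phi ->
  exists C c : R, 0 < C /\ 0 < c /\
    forall (n : nat) (hn : (0 < n)%N)
      (d : measure_display) (T : measurableType d) (P : probability T R)
      (eta : 'I_n -> {RV P >-> R})
      (hindep : mutually_independent eta)
      (hlaw : forall i : 'I_n, symmetric_weibull alpha (distribution P (eta i)))
      (A : 'M[R]_n) (hsym : A^T = A) (hdiag : forall i : 'I_n, A i i = 0)
      (t m : R), 0 < t -> 0 < nu n A ->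
    ((C * expR (- (c * phi alpha (t / nu n A))))%:E <=
       P [set w | (t <= `|quadratic_form A (random_vector eta w) - m|)%R])%E.
Proof.
move=> a0 a1 -> phi2 [C [c [C0 [c0 H]]]].
exists C, (c * 4); split => //; split; first by rewrite mulr_gt0.
move=> n n0 d T P eta indep law A AT A0 t m t0 nu0.
apply: (transfer a0 a1 n0 indep law (K := 1 + c * (2 * t / nu n A)) t0) => S tS.
apply: le_trans (H alpha _ S n A (2 * t) m n0 a0 a1 tS AT A0 nu0 _ (lexx _)); last first.
  by rewrite mulr_ge0 // ltW.
rewrite ler_pM2l // ler_expR lerN2 -[2 * t / _]mulrA -mulrA ler_pM2l //.
by apply: phi2; rewrite divr_ge0 // ltW.
Qed.

Lemma powR_double (R : realType) (rho b : R) : 0 <= rho -> 0 <= b <= 1 ->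
  (2 * rho) `^ b <= 4 * rho `^ b.
Proof.
move=> rho0 /andP[b0 b1]; rewrite powRM // ler_wpM2r ?powR_ge0 //.
apply: (@le_trans _ _ (2 `^ 1)); first by rewrite ler_powR // ler1n.
by rewrite powRr1 // ler_nat.
Qed.

Theorem proposition1p1 (R : realType) (alpha : R)
    (halpha0 : 0 < alpha) (halpha1 : alpha <= 1) :
  exists C c : R, 0 < C /\ 0 < c /\
    forall (n : nat) (hn : (0 < n)%N)
      (d : measure_display) (T : measurableType d) (P : probability T R)
      (eta : 'I_n -> {RV P >-> R})
      (hindep : mutually_independent eta)
      (hlaw : forall i : 'I_n, symmetric_weibull alpha (distribution P (eta i)))
      (A : 'M[R]_n) (hsym : A^T = A) (hdiag : forall i : 'I_n, A i i = 0)
      (t : R) (ht : 0 <= t),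
    let Q := fun w : T => quadratic_form A (random_vector eta w) in
    (C%:E * expeR (- (c%:E * f2 alpha A t)) <=
       P [set w | t%:E <= `|(Q w)%:E - 'E_P[Q]|])%E.
Proof.
pose q := 1 - expR (- ((4 / 3) `^ alpha - 1)).
have q0 : 0 < q.
  rewrite subr_gt0 -[ltRHS]expR0 ltr_expR oppr_lt0 subr_gt0.
  have p1 : 1 = 1 `^ alpha :> R by rewrite powR1.
  by rewrite [ltLHS]p1; apply: gt0_ltr_powR; rewrite ?nnegrE //; lra.
have q1 : q <= 1 by rewrite gerBl expR_ge0.
have A0 : 0 < 2 + alpha by rewrite addr_gt0.
have th3 : 0 < 2 * alpha / (2 + alpha) <= 1.
  by rewrite divr_gt0 ?mulr_gt0 //= ler_pdivrMr //; lra.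
have th4 : 0 < alpha / 2 <= 1 by rewrite divr_gt0 //=; lra.
have weak (b : R) : 0 < b <= 1 -> 0 <= b <= 1 by case/andP => /ltW -> ->.
have sqr_double (rho : R) : 0 <= rho -> (2 * rho) ^+ 2 <= 4 * rho ^+ 2.
  by move=> _; rewrite exprMn -natrX.
have double (rho : R) : 0 <= rho -> 2 * rho <= 4 * rho by move=> ?; lra.
have [C1 [c1 [C10 [c10 H1]]]] := real_tail halpha0 halpha1 (erefl q)
  sqr_double (finite_tail_frobenius q0 q1).
have [C2 [c2 [C20 [c20 H2]]]] := real_tail halpha0 halpha1 (erefl q)
  double (finite_tail_spectral q0 q1).
have [C3 [c3 [C30 [c30 H3]]]] := real_tail halpha0 halpha1 (erefl q)
  (fun rho rho0 => powR_double rho0 (weak _ th3)) (finite_tail_row q0 q1).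
have [C4 [c4 [C40 [c40 H4]]]] := real_tail halpha0 halpha1 (erefl q)
  (fun rho rho0 => powR_double rho0 (weak _ th4)) (finite_tail_entry q0).
(* C <= 1 makes the bound at most 1, which settles the cases where the event is the whole space. *)
pose C := Num.min 1 (Num.min (Num.min C1 C2) (Num.min C3 C4)).
pose c := c1 + c2 + c3 + c4.
have C0 : 0 < C by rewrite !lt_min ltr01 C10 C20 C30 C40.
have c0 : 0 < c by rewrite !addr_gt0.
exists C, c; split => //; split => // n n0 d T P eta indep law A AT A0' t t0.
lazy zeta; set Q := fun w : T => quadratic_form A (random_vector eta w).
have le1 : (C%:E * expeR (- (c%:E * f2 alpha A t)) <= 1)%E.
  rewrite -[leRHS]mule1; apply: lee_pmul => //.
  - by rewrite lee_fin ltW.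
  - exact: expeR_ge0.
  - by rewrite lee_fin ge_min lexx.
  - rewrite -expeR0 lee_expeR oppe_le0 mule_ge0 ?lee_fin ?(ltW c0) //.
    exact: f2_ge0.
have full : [set w | (t%:E <= `|(Q w)%:E - 'E_P[Q]|)%E] = setT ->
    (C%:E * expeR (- (c%:E * f2 alpha A t)) <= P [set w | t%:E <= `|(Q w)%:E - 'E_P[Q]|])%E.
  by move=> ->; rewrite probability_setT.
have [t00|tn0] := eqVneq t 0.
  by apply: full; apply/seteqP; split => // w _ /=; rewrite t00 abse_ge0.
have {tn0 t0} t0 : 0 < t by rewrite lt_def tn0.
(* An infinite expectation would make the deviation infinite everywhere; a finite one is just a
   particular centring. *)
case EQ : ('E_P[Q])%E => [m| |]; last 2 first.
- by rewrite -EQ; apply: full; apply/seteqP; split => // w _ /=; rewrite EQ /= leey.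
- by rewrite -EQ; apply: full; apply/seteqP; split => // w _ /=; rewrite EQ /= leey.
have -> : [set w | (t%:E <= `|(Q w)%:E - m%:E|)%E] =
    [set w | (t <= `|quadratic_form A (random_vector eta w) - m|)%R].
  by apply/seteqP; split => w /=; rewrite lee_fin.
set p := P _.
(* [good] passes to minima, since a minimum is one of its arguments, and holds at +oo, the value of
   the quotient for a zero norm. The four terms can thus be treated separately. *)
pose good (x : \bar R) := (C%:E * expeR (- (c%:E * x)) <= p)%E.
have good_infty : good +oo%E.
  by rewrite /good gt0_muley ?lte_fin //= mule0 measure_ge0.
have good_fin C' c' x : 0 <= x -> C <= C' -> 0 <= c' <= c ->
    ((C' * expR (- (c' * x)))%:E <= p)%E -> good x%:E.
  move=> x0 CC /andP[c00 cc] h; rewrite /good; apply: le_trans h.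
  rewrite -[(c%:E * _)%E]EFinM /= -EFinM lee_fin ler_pM ?expR_ge0 ?(ltW C0) //.
  by rewrite ler_expR lerN2 ler_wpM2r.
have good_min x y : good x -> good y -> good (Order.min x y).
  by rewrite /Order.min; case: ifP.
have [CC1 CC2 CC3 CC4] : [/\ C <= C1, C <= C2, C <= C3 & C <= C4].
  by split; rewrite /C !ge_min lexx ?orbT.
have [cc1 cc2 cc3 cc4] : [/\ 0 <= c1 <= c, 0 <= c2 <= c, 0 <= c3 <= c & 0 <= c4 <= c].
  by rewrite /c; split; lra.
have split_nu (nu : R) : 0 <= nu -> nu = 0 \/ 0 < nu.
  by rewrite le_eqVlt => /orP[/eqP|]; [left|right].
rewrite -/(good _) /f2.
apply: (good_min _ _); [|apply: (good_min _ _); [|apply: (good_min _ _)]].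
- have [->|F0] := split_nu _ (sqrtr_ge0 _ : 0 <= frobenius_norm A).
    by rewrite ediv0 // expe2 mulyy.
  rewrite edivE ?gt_eqF // -EFin_expe; apply: (good_fin C1 c1) => //; first exact: sqr_ge0.
  exact: H1.
- have [->|s0] := split_nu _ (spectral_norm_ge0 A).
    by rewrite ediv0.
  rewrite edivE ?gt_eqF //; apply: (good_fin C2 c2) => //.
    by rewrite divr_ge0 ?ltW.
  exact: H2.
- have [->|s0] := split_nu _ (l2_linfty_norm_ge0 A n0).
    by rewrite ediv0 // poweRyr // gt_eqF //; case/andP: th3.
  rewrite edivE ?gt_eqF // poweR_EFin; apply: (good_fin C3 c3) => //; first exact: powR_ge0.
  exact: H3.
- have [->|s0] := split_nu _ (mx_norm_ge0 A).
    by rewrite ediv0 // poweRyr // gt_eqF //; case/andP: th4.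
  rewrite edivE ?gt_eqF // poweR_EFin; apply: (good_fin C4 c4) => //; first exact: powR_ge0.
  exact: H4.
Qed.
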